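(* Fix constants $Q>0$, $n>0$, $\mu_i>0$, $\mu_o>0$, $0<R_1(0)<R_2(0)$ and a time $\tau\ge 0$. Put $R_0^2(\tau)=Q\tau/\pi$, $R_1^2(\tau)=Q\tau/\pi+R_1^2(0)$, $R_2^2(\tau)=Q\tau/\pi+R_2^2(0)$ and $\zeta_1=R_1^2(0)/R_2^2(0)$. Let $T_1,T_2$ be real constants and set $$F_1=\frac{Qn}{2\pi R_1^2(\tau)}\big(\mu(\zeta_1)-\mu_i\big)-T_1\frac{n^3-n}{R_1^3(\tau)},\qquad F_2=\frac{Qn}{2\pi R_2^2(\tau)}\big(\mu_o-\mu(1)\big)-T_2\frac{n^3-n}{R_2^3(\tau)},$$ and assume $F_1>0$ and $F_2>0$. Let $\mu$ be a positive, strictly increasing function in $C^1([\zeta_1,1])$. Consider the eigenvalue problem, for $f$ on $[\zeta_1,1]$ and $\lambda\in\mathbb{C}$: $$\Big(\big(\zeta R_2^2(0)+R_0^2(\tau)\big)\mu(\zeta) f'(\zeta)\Big)'-\Big(\frac{n^2R_2^4(0)}{4(\zeta R_2^2(0)+R_0^2(\tau))}\mu(\zeta)-\frac{Qn^2R_2^2(0)}{4\pi(\zeta R_2^2(0)+R_0^2(\tau))}\mu'(\zeta)\lambda\Big)f(\zeta)=0,\quad \zeta_1<\zeta<1,$$ $$(\mu_i-\lambda F_1)f(\zeta_1)-\frac{2R_1^2(\tau)}{nR_2^2(0)}\mu(\zeta_1)f'(\zeta_1)=0,\qquad (\mu_o-\lambda F_2)f(1)+\frac{2R_2^2(\tau)}{nR_2^2(0)}\mu(1)f'(1)=0.$$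 Then this problem has a countably infinite number of real eigenvalues, which can be ordered as $0<\lambda_0<\lambda_1<\lambda_2<\cdots$, such that the corresponding eigenfunction $f_i$ has exactly $i$ zeros in the open interval $(\zeta_1,1)$. Moreover, the eigenfunctions are continuous with continuous derivative.
   Context: This eigenvalue problem arises from the linear stability analysis of three-layer radial Hele-Shaw flow in a transformed coordinate $\zeta$; $\lambda=1/\sigma$ where $\sigma$ is the growth rate of a disturbance with angular wave number $n$, $\mu_i,\mu_o$ are the inner/outer fluid viscosities, $\mu(\zeta)$ is the middle-layer viscous profile, $T_1,T_2$ are interfacial tensions and $Q$ is the injection rate. *)

(* Defs.v *)
From Stdlib Require Import Reals Lra List.
From Coquelicot Require Import Coquelicot.
Open Scope R_scope.

Definition R0sq (Q tau : R) : R := Q * tau / PI.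
Definition R1sq (Q tau R10 : R) : R := Q * tau / PI + R10 ^ 2.
Definition R2sq (Q tau R20 : R) : R := Q * tau / PI + R20 ^ 2.
Definition zeta1 (R10 R20 : R) : R := R10 ^ 2 / R20 ^ 2.

Definition F1 (mu : R -> R) (Q n mui R10 R20 tau T1 : R) : R :=
  Q * n / (2 * PI * R1sq Q tau R10) * (mu (zeta1 R10 R20) - mui)
  - T1 * (n ^ 3 - n) / (sqrt (R1sq Q tau R10)) ^ 3.

Definition F2 (mu : R -> R) (Q n muo R20 tau T2 : R) : R :=
  Q * n / (2 * PI * R2sq Q tau R20) * (muo - mu 1)
  - T2 * (n ^ 3 - n) / (sqrt (R2sq Q tau R20)) ^ 3.

Definition cont_on (g : R -> R) (a b : R) : Prop :=
  forall x, a <= x <= b -> forall eps, 0 < eps ->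
    exists delta, 0 < delta /\
      forall y, a <= y <= b -> Rabs (y - x) < delta -> Rabs (g y - g x) < eps.

Definition C1_on (g : R -> R) (a b : R) : Prop :=
  (forall x, a <= x <= b -> ex_derive g x) /\ cont_on (Derive g) a b.

(* Complex eigenvalue lambda = la + i*lb, complex eigenfunction f = u + i*v.
   The eigenvalue problem, split into real and imaginary parts. *)
Definition eigenpair (mu : R -> R) (Q n mui muo R10 R20 tau T1 T2 : R)
    (la lb : R) (u v : R -> R) : Prop :=
  let z1 := zeta1 R10 R20 in
  let r0 := R0sq Q tau in
  let P := fun z => (z * R20 ^ 2 + r0) * mu z in
  let A := fun z => n ^ 2 * R20 ^ 4 / (4 * (z * R20 ^ 2 + r0)) * mu z in
  let B := fun z => Q * n ^ 2 * R20 ^ 2 / (4 * PI * (z * R20 ^ 2 + r0)) * Derive mu z in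
  let f1 := F1 mu Q n mui R10 R20 tau T1 in
  let f2 := F2 mu Q n muo R20 tau T2 in
  let c1 := 2 * R1sq Q tau R10 / (n * R20 ^ 2) in
  let c2 := 2 * R2sq Q tau R20 / (n * R20 ^ 2) in
  (forall z, z1 <= z <= 1 -> ex_derive u z /\ ex_derive v z) /\
  (forall z, z1 < z < 1 ->
     is_derive (fun y => P y * Derive u y) z
       ((A z - B z * la) * u z + B z * lb * v z) /\
     is_derive (fun y => P y * Derive v y) z
       ((A z - B z * la) * v z - B z * lb * u z)) /\
  (mui - la * f1) * u z1 + lb * f1 * v z1 - c1 * mu z1 * Derive u z1 = 0 /\
  (mui - la * f1) * v z1 - lb * f1 * u z1 - c1 * mu z1 * Derive v z1 = 0 /\
  (muo - la * f2) * u 1 + lb * f2 * v 1 + c2 * mu 1 * Derive u 1 = 0 /\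
  (muo - la * f2) * v 1 - lb * f2 * u 1 + c2 * mu 1 * Derive v 1 = 0 /\
  (exists z, z1 <= z <= 1 /\ (u z <> 0 \/ v z <> 0)).

Definition exactly_k_zeros (u v : R -> R) (a b : R) (k : nat) : Prop :=
  exists l : list R, length l = k /\ NoDup l /\
    forall x, In x l <-> (a < x < b /\ u x = 0 /\ v x = 0).

(* Main.v *)
(** Pruefer's method.  Writing a real solution as [f = r sin th],
    [P f' = r cos th], the phase solves the scalar equation
    [th' = cos^2 th / P + (lam B - A) sin^2 th].  The condition at the left end
    fixes [th] there to an angle in [(0, pi)] that increases with [lam]; the
    condition at the right end asks that [th] equal, modulo [pi], an angle
    [beta lam] in [(0, pi)] that decreases with [lam].  Hence
    [g lam = th(lam, b) - beta lam] is continuous and strictly increasing, with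
    [g 0 < 0], and it is unbounded because [B] is positive on some subinterval.
    The eigenvalues are the solutions of [g lam = k pi], and since [th] crosses
    multiples of [pi] only upwards, [k] counts the zeros of the eigenfunction.
    For nonreal [lam] the Wronskian of the real and imaginary parts is monotone
    with incompatible signs at the two ends. *)

Require Import Defs.
From Stdlib Require Import Reals ZArith Lra Lia List ClassicalEpsilon.
From Coquelicot Require Import Coquelicot.
Open Scope R_scope.

(** * Functions on a compact interval *)

(** [B] is a multiple of the derivative of [mu], which may vanish on most of the interval. Growth of
    the phase is therefore extracted on a subinterval where [B] is bounded below, by a rescaled
    angle, and then has to survive up to the right end. Strict monotonicity of [g] is drawn from the
    target [beta] alone, that is from [F2 > 0]. The equation is imposed on the open interval, while
    the boundary conditions use the two-sided [Derive] at the endpoints. A first-order system with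
    components differentiable on the whole line carries the equation to the closed interval. For a
    real parameter the eigenfunction may still be complex; both its parts are multiples of one real
    solution, so their common zeros are those of [sin th]. The coefficients are controlled on the
    interval only. Composition with [clamp] makes them continuous and bounded everywhere, and as the
    angle enters through [sin th ^ 2] alone, the phase equation becomes globally Lipschitz. *)

Definition clamp (a b x : R) : R := Rmax a (Rmin x b).

Lemma clamp_in a b x : a <= b -> a <= clamp a b x <= b.
Proof.
  intros ab; unfold clamp, Rmax, Rmin.
  repeat destruct (Rle_dec _ _); lra.
Qed.

Lemma clamp_id a b x : a <= x <= b -> clamp a b x = x.
Proof.
  intros xab; unfold clamp, Rmax, Rmin.
  repeat destruct (Rle_dec _ _); lra.
Qed.

Lemma clamp_contract a b x y :
  a <= b -> Rabs (clamp a b x - clamp a b y) <= Rabs (x - y).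
Proof.
  intros ab; unfold clamp, Rmax, Rmin.
  repeat destruct (Rle_dec _ _);
    unfold Rabs; repeat destruct (Rcase_abs _); lra.
Qed.

Lemma continuous_of_eps (f : R -> R) (x : R) :
  (forall eps, 0 < eps -> exists delta, 0 < delta /\
     forall y, Rabs (y - x) < delta -> Rabs (f y - f x) < eps) ->
  continuous f x.
Proof.
  intros H; apply filterlim_locally; intros eps.
  destruct (H eps (cond_pos eps)) as [d [dp Hd]].
  exists (mkposreal d dp); intros y Hy; apply Hd, Hy.
Qed.

Lemma eps_of_continuous (f : R -> R) (x : R) :
  continuous f x ->
  forall eps, 0 < eps -> exists delta, 0 < delta /\
     forall y, Rabs (y - x) < delta -> Rabs (f y - f x) < eps.
Proof.
  intros H eps ep.
  destruct (proj1 (filterlim_locally _ _) H (mkposreal eps ep)) as [d Hd].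
  exists d; split; [apply cond_pos | intros y Hy; apply (Hd y Hy)].
Qed.

Lemma continuous_clamp g a b x :
  a <= b -> cont_on g a b -> continuous (fun y => g (clamp a b y)) x.
Proof.
  intros ab Hg; apply continuous_of_eps; intros eps ep.
  destruct (Hg _ (clamp_in a b x ab) eps ep) as [d [dp Hd]].
  exists d; split; [exact dp | intros y Hy].
  apply Hd; [now apply clamp_in |].
  apply Rle_lt_trans with (1 := clamp_contract a b y x ab), Hy.
Qed.

Lemma cont_on_continuous g a b :
  (forall x, a <= x <= b -> continuous g x) -> cont_on g a b.
Proof.
  intros Hg x xab eps ep.
  destruct (eps_of_continuous g x (Hg x xab) eps ep) as [d [dp Hd]].
  exists d; split; [exact dp | intros y _ Hy; now apply Hd].
Qed.

Lemma cont_on_ext f g a b :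
  (forall x, a <= x <= b -> f x = g x) -> cont_on g a b -> cont_on f a b.
Proof.
  intros E Hg x xab eps ep.
  destruct (Hg x xab eps ep) as [d [dp Hd]].
  exists d; split; [exact dp | intros y yab Hy].
  rewrite !E by assumption; now apply Hd.
Qed.

Lemma cont_on_mult f g a b :
  cont_on f a b -> cont_on g a b -> a <= b -> cont_on (fun x => f x * g x) a b.
Proof.
  intros Cf Cg ab.
  apply (cont_on_ext _ (fun x => f (clamp a b x) * g (clamp a b x))).
  { intros x Hx; now rewrite clamp_id. }
  apply cont_on_continuous; intros x _.
  apply (continuous_mult (fun x => f (clamp a b x)) (fun x => g (clamp a b x)));
    now apply continuous_clamp.
Qed.

Lemma bounded_above_continuous (g : R -> R) (a b : R) :
  a <= b -> (forall x, continuous g x) ->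
  exists M, 0 < M /\ forall x, a <= x <= b -> g x <= M.
Proof.
  intros ab Hg.
  destruct (continuity_ab_maj g a b ab) as [m [Hm _]].
  { intros c _; apply continuity_pt_filterlim, Hg. }
  exists (Rmax 1 (g m)); split; [apply Rlt_le_trans with 1; [lra | apply Rmax_l] |].
  intros x Hx; apply Rle_trans with (g m); [now apply Hm | apply Rmax_r].
Qed.

Lemma mean_value (f df : R -> R) (a b : R) :
  a <= b -> (forall x, a <= x <= b -> is_derive f x (df x)) ->
  exists c, a <= c <= b /\ f b - f a = df c * (b - a).
Proof.
  intros ab Hf.
  destruct (MVT_gen f a b df) as [c [Hc E]];
    rewrite ?Rmin_left, ?Rmax_right by lra.
  - intros x Hx; apply Hf; lra.
  - intros x Hx; apply continuity_pt_filterlim.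
    apply @ex_derive_continuous; exists (df x); now apply Hf.
  - rewrite Rmin_left, Rmax_right in Hc by lra; now exists c.
Qed.

Lemma nondecreasing_of_derive (f df : R -> R) (a b : R) :
  a <= b -> (forall x, a <= x <= b -> is_derive f x (df x)) ->
  (forall x, a <= x <= b -> 0 <= df x) -> f a <= f b.
Proof.
  intros ab Hf Hp.
  destruct (mean_value f df a b ab Hf) as [c [Hc E]].
  specialize (Hp c Hc); nra.
Qed.

Lemma increasing_of_derive (f df : R -> R) (a b : R) :
  a < b -> (forall x, a <= x <= b -> is_derive f x (df x)) ->
  (forall x, a <= x <= b -> 0 < df x) -> f a < f b.
Proof.
  intros ab Hf Hp.
  destruct (mean_value f df a b (Rlt_le _ _ ab) Hf) as [c [Hc E]].
  specialize (Hp c Hc); nra.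
Qed.

Lemma constant_of_derive (f : R -> R) (a b : R) :
  (forall x, a <= x <= b -> is_derive f x 0) ->
  forall x, a <= x <= b -> f x = f a.
Proof.
  intros Hf x Hx.
  destruct (mean_value f (fun _ => 0) a x) as [c [_ E]]; [lra | | lra].
  intros y Hy; apply Hf; lra.
Qed.

(** Both [g - f] and [g + f] have nonnegative derivative and start nonnegative. The Lipschitz
    constants and the Picard error bounds come from this. *)
Lemma Rabs_le_of_derive (f df g dg : R -> R) (a b : R) :
  (forall x, a <= x <= b -> is_derive f x (df x)) ->
  (forall x, a <= x <= b -> is_derive g x (dg x)) ->
  (forall x, a <= x <= b -> Rabs (df x) <= dg x) ->
  Rabs (f a) <= g a ->
  forall x, a <= x <= b -> Rabs (f x) <= g x.
Proof.
  intros Hf Hg Hd Ha x Hx.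
  assert (H1 : g a - f a <= g x - f x).
  { apply (nondecreasing_of_derive (fun y => g y - f y) (fun y => dg y - df y));
      [lra | |].
    - intros y Hy; apply @is_derive_minus; [apply Hg | apply Hf]; lra.
    - intros y Hy; assert (H := Hd y ltac:(lra)); apply Rabs_le_between in H; lra. }
  assert (H2 : g a + f a <= g x + f x).
  { apply (nondecreasing_of_derive (fun y => g y + f y) (fun y => dg y + df y));
      [lra | |].
    - intros y Hy; apply @is_derive_plus; [apply Hg | apply Hf]; lra.
    - intros y Hy; assert (H := Hd y ltac:(lra)); apply Rabs_le_between in H; lra. }
  apply Rabs_le_between in Ha; apply Rabs_le_between; lra.
Qed.

Lemma is_derive_RInt_continuous (f : R -> R) (a x : R) :
  (forall y, continuous f y) -> is_derive (fun z => RInt f a z) x (f x).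
Proof.
  intros Hf; apply (is_derive_RInt f (fun z => RInt f a z) a); [| apply Hf].
  apply filter_forall; intros y.
  apply @RInt_correct, @ex_RInt_continuous; intros z _; apply Hf.
Qed.

Lemma is_derive_mul_exp (f : R -> R) (df K x : R) :
  is_derive f x df ->
  is_derive (fun y => f y * exp (K * y)) x ((df + K * f x) * exp (K * x)).
Proof.
  intros H; auto_derive; [now exists df |].
  change (Derive (fun y => f y) x) with (Derive f x); rewrite (is_derive_unique _ _ _ H); ring.
Qed.

(** * Gronwall's inequality and scalar comparison *)

Lemma gronwall (f df : R -> R) K a b :
  (forall x, a <= x <= b -> is_derive f x (df x)) ->
  (forall x, a <= x <= b -> df x <= K * f x) ->
  forall x, a <= x <= b -> f x <= f a * exp (K * (x - a)).
Proof.
  intros Hf Hd x Hx.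
  assert (H : - (f a * exp (- K * a)) <= - (f x * exp (- K * x))).
  { apply (nondecreasing_of_derive (fun y => - (f y * exp (- K * y)))
             (fun y => - ((df y + - K * f y) * exp (- K * y)))); [lra | |].
    - intros y Hy; apply @is_derive_opp, is_derive_mul_exp, Hf; lra.
    - intros y Hy; assert (h := Hd y ltac:(lra)).
      assert (e := exp_pos (- K * y)); nra. }
  replace (f x) with (f x * exp (- K * x) * exp (K * x)).
  2:{ rewrite Rmult_assoc, <- exp_plus.
      replace (- K * x + K * x) with 0 by ring; rewrite exp_0; ring. }
  replace (f a * exp (K * (x - a))) with (f a * exp (- K * a) * exp (K * x)).
  2:{ rewrite Rmult_assoc, <- exp_plus; do 2 f_equal; ring. }
  apply Rmult_le_compat_r; [left; apply exp_pos | lra].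
Qed.

Lemma is_derive_negpart_sqr x :
  is_derive (fun y => Rmin y 0 ^ 2) x (2 * Rmin x 0).
Proof.
  apply is_derive_Reals; intros eps ep.
  (* The increment minus its linear part is at most [h ^ 2] in absolute value in every sign case, so
     [delta = eps] works. *)
  exists (mkposreal eps ep); simpl; intros h h0 hd.
  replace (_ / h - _)
    with ((Rmin (x + h) 0 * (Rmin (x + h) 0 * 1) - Rmin x 0 * (Rmin x 0 * 1)
           - 2 * Rmin x 0 * h) / h) by (field; exact h0).
  unfold Rdiv; rewrite Rabs_mult, Rabs_inv.
  assert (hp := Rabs_pos_lt h h0).
  apply Rle_lt_trans with (2 := hd).
  apply Rmult_le_reg_r with (1 := hp).
  rewrite Rmult_assoc, Rinv_l, Rmult_1_r by lra.
  replace (Rabs h * Rabs h) with (h * h) by (rewrite <- Rabs_mult, Rabs_pos_eq; nra).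
  apply Rabs_le_between.
  unfold Rmin; repeat destruct (Rle_dec _ _); nra.
Qed.

(* Gronwall for the square of the negative part, which is C^1. *)
Lemma comparison_le (d dd : R -> R) K a b :
  (forall x, a <= x <= b -> is_derive d x (dd x)) ->
  (forall x, a <= x <= b -> - K * Rabs (d x) <= dd x) ->
  0 <= d a -> forall x, a <= x <= b -> 0 <= d x.
Proof.
  intros Hd Hdd Ha x Hx.
  assert (G : Rmin (d x) 0 ^ 2 <= Rmin (d a) 0 ^ 2 * exp (2 * K * (x - a))).
  { apply (gronwall (fun y => Rmin (d y) 0 ^ 2)
             (fun y => dd y * (2 * Rmin (d y) 0)) _ a b); [| | exact Hx].
    - intros y Hy.
      apply (is_derive_comp (fun z => Rmin z 0 ^ 2) d);
        [apply is_derive_negpart_sqr | now apply Hd].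
    - intros y Hy; assert (h := Hdd y Hy); revert h.
      unfold Rmin; destruct (Rle_dec (d y) 0) as [l | l].
      + rewrite Rabs_left1 by exact l; nra.
      + intros _; nra. }
  rewrite (Rmin_right (d a)) in G by exact Ha.
  unfold Rmin in G; destruct (Rle_dec (d x) 0); nra.
Qed.

(** Once [comparison_le] gives [0 <= d], the absolute value drops and [d x * exp (K * x)] is
    nondecreasing, so it stays above its positive initial value. *)
Lemma comparison_lt (d dd : R -> R) K a b :
  (forall x, a <= x <= b -> is_derive d x (dd x)) ->
  (forall x, a <= x <= b -> - K * Rabs (d x) <= dd x) ->
  0 < d a -> forall x, a <= x <= b -> 0 < d x.
Proof.
  intros Hd Hdd Ha x Hx.
  assert (P := comparison_le d dd K a b Hd Hdd (Rlt_le _ _ Ha)).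
  assert (G : d a * exp (K * a) <= d x * exp (K * x)).
  { apply (nondecreasing_of_derive (fun y => d y * exp (K * y))
             (fun y => (dd y + K * d y) * exp (K * y))); [lra | |].
    - intros y Hy; apply is_derive_mul_exp, Hd; lra.
    - intros y Hy; assert (h := Hdd y ltac:(lra)).
      rewrite Rabs_pos_eq in h by (apply P; lra).
      assert (e := exp_pos (K * y)); nra. }
  assert (e := exp_pos (K * x)); assert (e' := exp_pos (K * a)); nra.
Qed.

(** As in [comparison_lt], but the strict differential inequality makes [d x * exp (K * x)] strictly
    increasing, so a start at zero is left upwards at once. *)
Lemma comparison_cross (d dd : R -> R) K a b :
  (forall x, a <= x <= b -> is_derive d x (dd x)) ->
  (forall x, a <= x <= b -> - K * Rabs (d x) < dd x) ->
  0 <= d a -> forall x, a < x <= b -> 0 < d x.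
Proof.
  intros Hd Hdd Ha x Hx.
  assert (P := comparison_le d dd K a b Hd (fun y Hy => Rlt_le _ _ (Hdd y Hy)) Ha).
  assert (G : d a * exp (K * a) < d x * exp (K * x)).
  { apply (increasing_of_derive (fun y => d y * exp (K * y))
             (fun y => (dd y + K * d y) * exp (K * y))); [lra | |].
    - intros y Hy; apply is_derive_mul_exp, Hd; lra.
    - intros y Hy; assert (h := Hdd y ltac:(lra)).
      rewrite Rabs_pos_eq in h by (apply P; lra).
      assert (e := exp_pos (K * y)); nra. }
  assert (e := exp_pos (K * x)); assert (e' := exp_pos (K * a)); nra.
Qed.

(** * Picard iteration *)

Lemma zero_of_geometric_bound x c : (forall n, Rabs x <= c * (1 / 2) ^ n) -> x = 0.
Proof.
  intros H.
  assert (L : Rbar_le (Rabs x) (Rbar_mult c 0)).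
  { apply (is_lim_seq_le (fun _ => Rabs x) (fun n => c * (1 / 2) ^ n));
      [exact H | apply is_lim_seq_const |].
    apply (is_lim_seq_scal_l (fun n => (1 / 2) ^ n) c 0).
    apply is_lim_seq_geom; rewrite Rabs_pos_eq; lra. }
  simpl in L; rewrite Rmult_0_r in L.
  destruct (Req_dec x 0) as [E | E]; [exact E |].
  assert (h := Rabs_pos_lt x E); lra.
Qed.

Lemma limit_of_geometric_increments (u : nat -> R) c :
  (forall n, Rabs (u (S n) - u n) <= c * (1 / 2) ^ n) ->
  exists l, forall n, Rabs (l - u n) <= 2 * c * (1 / 2) ^ n.
Proof.
  intros H.
  (* The right-hand side is the exact sum of the [k] geometric increments; keeping the subtracted
     term lets the induction close. *)
  assert (T : forall n k, Rabs (u (n + k)%nat - u n)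
                 <= 2 * c * (1 / 2) ^ n - 2 * c * (1 / 2) ^ (n + k)).
  { intros n; induction k as [| k IH].
    - rewrite Nat.add_0_r; unfold Rminus; rewrite !Rplus_opp_r, Rabs_R0; lra.
    - rewrite Nat.add_succ_r.
      replace (u (S (n + k)) - u n)
        with ((u (S (n + k)) - u (n + k)%nat) + (u (n + k)%nat - u n)) by ring.
      eapply Rle_trans; [apply Rabs_triang |].
      specialize (H (n + k)%nat); simpl pow; lra. }
  assert (c0 : 0 <= c).
  { generalize (H 0%nat) (Rabs_pos (u 1%nat - u 0%nat)); simpl; lra. }
  assert (T' : forall n k, Rabs (u (n + k)%nat - u n) <= 2 * c * (1 / 2) ^ n).
  { intros n k; assert (h := T n k).
    assert (0 < (1 / 2) ^ (n + k)) by (apply pow_lt; lra); nra. }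
  assert (E : ex_finite_lim_seq u).
  { apply ex_lim_seq_cauchy_corr; intros eps.
    (* Two terms beyond [N] each lie within [2 * c * (1 / 2) ^ N] of [u N], whence the factor 4. *)
    assert (G := is_lim_seq_scal_l _ (4 * c) _ (is_lim_seq_geom (1 / 2)
                   ltac:(rewrite Rabs_pos_eq; lra))).
    apply is_lim_seq_spec in G; simpl in G.
    specialize (G eps); destruct G as [N G]; exists N; intros n m Hn Hm.
    specialize (G N (le_n N)).
    rewrite Rmult_0_r, Rminus_0_r in G; apply Rabs_lt_between in G.
    assert (A := T' N (n - N)%nat); assert (B := T' N (m - N)%nat).
    replace (N + (n - N))%nat with n in A by lia.
    replace (N + (m - N))%nat with m in B by lia.
    apply Rabs_le_between in A; apply Rabs_le_between in B.
    apply Rabs_lt_between; lra. }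
  destruct E as [l El]; exists l; intros n.
  assert (L : is_lim_seq (fun k => Rabs (u (k + n)%nat - u n)) (Rabs (l - u n))).
  { apply (is_lim_seq_abs (fun k => u (k + n)%nat - u n) (Finite (l - u n))).
    apply is_lim_seq_minus'; [| apply is_lim_seq_const].
    now apply (is_lim_seq_incr_n u n l). }
  apply (is_lim_seq_le _ (fun _ => 2 * c * (1 / 2) ^ n) _ _) with (2 := L)
    (3 := is_lim_seq_const _).
  intros k; rewrite Nat.add_comm; apply T'.
Qed.

Fixpoint picard_iterate (F : R -> R -> R) (a alpha : R) (n : nat) : R -> R :=
  match n with
  | O => fun _ => alpha
  | S k => fun x => alpha + RInt (fun t => F t (picard_iterate F a alpha k t)) a x
  end.

(** Increments are measured against the weight [exp (2 * L * (x - a))]: integrating [L] times the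
    weight gains a factor 1/2, so the iteration converges on the whole interval whatever its length.
    Continuity of [F] is asked along continuous curves, the form in which the integrals use it. *)
Lemma picard (F : R -> R -> R) (L a b alpha : R) :
  a <= b -> 0 < L ->
  (forall t x y, Rabs (F t x - F t y) <= L * Rabs (x - y)) ->
  (forall th, (forall x, continuous th x) ->
     forall x, continuous (fun t => F t (th t)) x) ->
  exists th, th a = alpha /\ (forall x, continuous th x) /\
    forall x, a <= x <= b -> is_derive th x (F x (th x)).
Proof.
  intros ab L0 FL FC.
  set (u := picard_iterate F a alpha).
  assert (der : forall th x, (forall y, continuous th y) ->
    is_derive (fun x => alpha + RInt (fun t => F t (th t)) a x) x (F x (th x))).
  { intros th x C.
    replace (F x (th x)) with (0 + F x (th x)) by ring.
    apply @is_derive_plus; [apply @is_derive_const |].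
    apply (is_derive_RInt_continuous (fun t => F t (th t))), FC, C. }
  assert (uC : forall n x, continuous (u n) x).
  { induction n as [| n IH]; intros x; [apply continuous_const |].
    apply @ex_derive_continuous; eexists; apply (der (u n) x), IH. }
  assert (uD : forall n x, is_derive (u (S n)) x (F x (u n x))).
  { intros n x; apply (der (u n) x), uC. }
  assert (ua : forall n, u n a = alpha).
  { intros [| n]; [reflexivity |].
    unfold u; simpl; rewrite RInt_point; apply Rplus_0_r. }
  destruct (bounded_above_continuous (fun x => Rabs (F x alpha)) a b ab)
    as [M [M0 HM]].
  { intros x; apply continuous_comp with (g := Rabs);
      [apply (FC (fun _ => alpha)); intros; apply continuous_const
      | apply continuous_Rabs]. }
  set (C := M * (b - a)).
  assert (C0 : 0 <= C) by (unfold C; nra).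
  assert (step : forall n x, a <= x <= b ->
    Rabs (u (S n) x - u n x) <= C * (1 / 2) ^ n * exp (2 * L * (x - a))).
  { induction n as [| n IH]; intros x Hx.
    - apply Rle_trans with (M * (x - a)).
      + apply (Rabs_le_of_derive (fun y => u 1%nat y - u 0%nat y)
                 (fun y => F y alpha) (fun y => M * (y - a)) (fun _ => M) a b);
          [| | exact HM | | exact Hx].
        * intros y _; replace (F y alpha) with (F y alpha - 0) by ring.
          apply @is_derive_minus; [apply (uD 0%nat) | apply @is_derive_const].
        * intros y _; auto_derive; [trivial | ring].
        * rewrite !ua; unfold Rminus; rewrite !Rplus_opp_r, Rabs_R0; lra.
      + simpl; assert (1 <= exp (2 * L * (x - a))).
        { rewrite <- exp_0; destruct (Rle_lt_or_eq_dec a x) as [h | h]; [lra | |].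
          - left; apply exp_increasing; nra.
          - rewrite h; right; f_equal; ring. }
        unfold C; rewrite Rmult_1_r.
        apply Rle_trans with (M * (b - a)); [nra |].
        rewrite <- (Rmult_1_r (M * (b - a))) at 1.
        apply Rmult_le_compat_l; [exact C0 | lra].
    - apply (Rabs_le_of_derive (fun y => u (S (S n)) y - u (S n) y)
               (fun y => F y (u (S n) y) - F y (u n y))
               (fun y => C * (1 / 2) ^ S n * exp (2 * L * (y - a)))
               (fun y => L * (C * (1 / 2) ^ n * exp (2 * L * (y - a)))) a b);
        [| | | | exact Hx].
      + intros y _; apply @is_derive_minus; apply uD.
      + intros y _; auto_derive; [trivial | simpl; unfold Rminus; field].
      + intros y Hy; apply Rle_trans with (1 := FL _ _ _).
        apply Rmult_le_compat_l; [lra | now apply IH].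
      + rewrite !ua; unfold Rminus; rewrite Rplus_opp_r, Rabs_R0.
        apply Rmult_le_pos; [apply Rmult_le_pos; [exact C0 |] |].
        * apply pow_le; lra.
        * left; apply exp_pos. }
  set (E := C * exp (2 * L * (b - a))).
  assert (step' : forall n x, a <= x <= b ->
    Rabs (u (S n) x - u n x) <= E * (1 / 2) ^ n).
  { intros n x Hx; apply Rle_trans with (1 := step n x Hx).
    unfold E.
    assert (0 < (1 / 2) ^ n) by (apply pow_lt; lra).
    assert (exp (2 * L * (x - a)) <= exp (2 * L * (b - a))).
    { destruct (Rle_lt_or_eq_dec x b) as [h | h]; [lra | |].
      - left; apply exp_increasing; nra.
      - rewrite h; lra. }
    replace (C * (1 / 2) ^ n * exp (2 * L * (x - a)))
      with (C * exp (2 * L * (x - a)) * (1 / 2) ^ n) by ring.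
    apply Rmult_le_compat_r; [lra |]; apply Rmult_le_compat_l; assumption. }
  (* The estimate holds on [[a, b]]; evaluating at the clamped point gives a limit that is defined,
     and then continuous, on the whole line. *)
  assert (lim : forall x, exists l, forall n,
    Rabs (l - u n (clamp a b x)) <= 2 * E * (1 / 2) ^ n).
  { intros x; apply (limit_of_geometric_increments (fun n => u n (clamp a b x))).
    intros n; apply step', clamp_in, ab. }
  set (th1 := fun x => proj1_sig (constructive_indefinite_description _ (lim x))).
  assert (th1L : forall x n, Rabs (th1 x - u n (clamp a b x)) <= 2 * E * (1 / 2) ^ n).
  { intros x; unfold th1; now destruct (constructive_indefinite_description _ _). }
  assert (E0 : 0 <= E) by (unfold E; assert (e := exp_pos (2 * L * (b - a))); nra).
  assert (th1C : forall x, continuous th1 x).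
  { intros x; apply continuous_of_eps; intros eps ep.
    assert (G := is_lim_seq_scal_l _ (2 * E) _ (is_lim_seq_geom (1 / 2)
                   ltac:(rewrite Rabs_pos_eq; lra))).
    apply is_lim_seq_spec in G; simpl in G.
    destruct (G (mkposreal (eps / 3) ltac:(lra))) as [N HN].
    specialize (HN N (le_n N)); simpl in HN.
    rewrite Rmult_0_r, Rminus_0_r in HN; apply Rabs_lt_between in HN.
    destruct (eps_of_continuous _ _ (uC N (clamp a b x)) (eps / 3) ltac:(lra))
      as [d [dp Hd]].
    exists d; split; [exact dp | intros y Hy].
    assert (A := th1L x N); assert (B := th1L y N).
    assert (D := Hd (clamp a b y) (Rle_lt_trans _ _ _ (clamp_contract a b y x ab) Hy)).
    apply Rabs_le_between in A; apply Rabs_le_between in B.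
    apply Rabs_lt_between in D; apply Rabs_lt_between; lra. }
  (* [th1] is known only as a uniform limit of continuous functions. One more application of the
     integral operator gives a differentiable function, shown next to agree with [th1] on the
     interval. *)
  set (th := fun x => alpha + RInt (fun t => F t (th1 t)) a x).
  assert (thD : forall x, is_derive th x (F x (th1 x))).
  { intros x; apply (der th1 x), th1C. }
  assert (thE : forall x, a <= x <= b -> th x = th1 x).
  { intros x Hx; apply Rminus_diag_uniq.
    (* Both functions are compared with [u (S n)]: integrating [L] times the error of [u n] gives
       the first summand, and [2 * E * (1 / 2) ^ S n = E * (1 / 2) ^ n] the second. *)
    apply (zero_of_geometric_bound _ (L * (2 * E) * (x - a) + E)); intros n.
    assert (A : Rabs (th x - u (S n) x) <= L * (2 * E * (1 / 2) ^ n) * (x - a)).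
    { apply (Rabs_le_of_derive (fun y => th y - u (S n) y)
               (fun y => F y (th1 y) - F y (u n y))
               (fun y => L * (2 * E * (1 / 2) ^ n) * (y - a))
               (fun _ => L * (2 * E * (1 / 2) ^ n)) a b); [| | | | exact Hx].
      - intros y _; apply @is_derive_minus; [apply thD | apply uD].
      - intros y _; auto_derive; [trivial | simpl; ring].
      - intros y Hy; apply Rle_trans with (1 := FL _ _ _).
        apply Rmult_le_compat_l; [lra |].
        assert (h := th1L y n); now rewrite (clamp_id a b y Hy) in h.
      - rewrite ua; unfold th; rewrite RInt_point, Rplus_0_r.
        unfold Rminus; rewrite !Rplus_opp_r, Rabs_R0; lra. }
    assert (B := th1L x (S n)); rewrite (clamp_id a b x Hx) in B; simpl in B.
    apply Rabs_le_between in A; apply Rabs_le_between in B.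
    apply Rabs_le_between; split; nra. }
  exists th; split; [| split].
  - unfold th; rewrite RInt_point; apply Rplus_0_r.
  - intros x; apply @ex_derive_continuous; eexists; apply thD.
  - intros x Hx; rewrite (thE x Hx); apply thD.
Qed.

(** * The phase equation *)

(** The derivative [2 sin z cos z] lies in [[-1, 1]] because the squares of [sin z + cos z] and
    [sin z - cos z] are nonnegative. *)
Lemma sin_sqr_lipschitz x y : Rabs (sin x ^ 2 - sin y ^ 2) <= Rabs (x - y).
Proof.
  assert (W : forall x y, x <= y -> Rabs (sin y ^ 2 - sin x ^ 2) <= y - x).
  { clear x y; intros x y xy.
    apply (Rabs_le_of_derive (fun z => sin z ^ 2 - sin x ^ 2)
             (fun z => 2 * sin z * cos z) (fun z => z - x) (fun _ => 1) x y);
      [| | | | lra].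
    - intros z _; auto_derive; [trivial | ring].
    - intros z _; auto_derive; [trivial | ring].
    - intros z _; assert (h := sin2_cos2 z); unfold Rsqr in h.
      assert (h1 := pow2_ge_0 (sin z + cos z)); assert (h2 := pow2_ge_0 (sin z - cos z)).
      apply Rabs_le_between; lra.
    - unfold Rminus; rewrite !Rplus_opp_r, Rabs_R0; lra. }
  destruct (Rle_dec x y) as [h | h].
  - rewrite (Rabs_minus_sym (sin x ^ 2)), (Rabs_minus_sym x), (Rabs_pos_eq (y - x)) by lra.
    now apply W.
  - rewrite (Rabs_pos_eq (x - y)) by lra; apply W; lra.
Qed.

Lemma atan_lipschitz x y : Rabs (atan x - atan y) <= Rabs (x - y).
Proof.
  assert (W : forall x y, x <= y -> Rabs (atan y - atan x) <= y - x).
  { clear x y; intros x y xy.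
    apply (Rabs_le_of_derive (fun z => atan z - atan x)
             (fun z => / (1 + z ^ 2)) (fun z => z - x) (fun _ => 1) x y);
      [| | | | lra].
    - intros z _; auto_derive; [trivial | field; nra].
    - intros z _; auto_derive; [trivial | ring].
    - intros z _; rewrite Rabs_pos_eq by (left; apply Rinv_0_lt_compat; nra).
      rewrite <- Rinv_1; apply Rinv_le_contravar; nra.
    - unfold Rminus; rewrite !Rplus_opp_r, Rabs_R0; lra. }
  destruct (Rle_dec x y) as [h | h].
  - rewrite (Rabs_minus_sym (atan x)), (Rabs_minus_sym x), (Rabs_pos_eq (y - x)) by lra.
    now apply W.
  - rewrite (Rabs_pos_eq (x - y)) by lra; apply W; lra.
Qed.

(** [p] stands for [1 / P]. The bounds are asked on the whole line, where the clamped coefficients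
    satisfy them. *)
Record coefficients (p A B : R -> R) (a b m M : R) : Prop := {
  co_ab : a < b;
  co_m : 0 < m;
  co_p_cont : forall x, continuous p x;
  co_A_cont : forall x, continuous A x;
  co_B_cont : forall x, continuous B x;
  co_p : forall x, m <= p x <= M;
  co_A : forall x, 0 <= A x <= M;
  co_B : forall x, 0 <= B x <= M }.

Definition pruefer (p A B : R -> R) (lam t th : R) : R :=
  p t * cos th ^ 2 + (lam * B t - A t) * sin th ^ 2.

Definition pruefer_angle p A B a b lam (th : R -> R) : Prop :=
  (forall x, continuous th x) /\
  forall x, a <= x <= b -> is_derive th x (pruefer p A B lam x (th x)).

Definition lipschitz_bound (lam M : R) : R := Rabs lam * M + 2 * M.

Lemma lipschitz_bound_pos p A B a b m M lam :
  coefficients p A B a b m M -> 0 < lipschitz_bound lam M.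
Proof.
  intros H; assert (h := co_m _ _ _ _ _ _ _ H); assert (h' := co_p _ _ _ _ _ _ _ H 0).
  unfold lipschitz_bound; assert (h2 := Rabs_pos lam); nra.
Qed.

(** With [cos ^ 2 = 1 - sin ^ 2] the right-hand side is [p + (lam B - A - p) sin ^ 2];
    [lipschitz_bound] bounds the factor of [sin ^ 2], uniformly in [t]. *)
Lemma pruefer_lipschitz p A B a b m M lam t x y :
  coefficients p A B a b m M ->
  Rabs (pruefer p A B lam t x - pruefer p A B lam t y)
    <= lipschitz_bound lam M * Rabs (x - y).
Proof.
  intros H.
  replace (pruefer p A B lam t x - pruefer p A B lam t y)
    with ((lam * B t - A t - p t) * (sin x ^ 2 - sin y ^ 2)).
  2:{ unfold pruefer; assert (hx := sin2_cos2 x); assert (hy := sin2_cos2 y).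
      unfold Rsqr in hx, hy.
      replace (cos x ^ 2) with (1 - sin x ^ 2) by lra.
      replace (cos y ^ 2) with (1 - sin y ^ 2) by lra; ring. }
  rewrite Rabs_mult; apply Rmult_le_compat; try apply Rabs_pos;
    [| apply sin_sqr_lipschitz].
  assert (hp := co_p _ _ _ _ _ _ _ H t); assert (hA := co_A _ _ _ _ _ _ _ H t).
  assert (hB := co_B _ _ _ _ _ _ _ H t); assert (hm := co_m _ _ _ _ _ _ _ H).
  assert (E : Rabs (lam * B t) <= Rabs lam * M).
  { rewrite Rabs_mult, (Rabs_pos_eq (B t)) by lra.
    apply Rmult_le_compat_l; [apply Rabs_pos | lra]. }
  apply Rabs_le_between in E; unfold lipschitz_bound; apply Rabs_le_between; lra.
Qed.

Lemma pruefer_angle_exists p A B a b m M lam alpha :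
  coefficients p A B a b m M ->
  exists th, th a = alpha /\ pruefer_angle p A B a b lam th.
Proof.
  intros H.
  destruct (picard (pruefer p A B lam) (lipschitz_bound lam M) a b alpha)
    as [th [E [C D]]].
  - left; apply (co_ab _ _ _ _ _ _ _ H).
  - apply (lipschitz_bound_pos _ _ _ _ _ _ _ _ H).
  - intros t x y; apply (pruefer_lipschitz _ _ _ _ _ _ _ _ _ _ _ H).
  - intros th C x; unfold pruefer.
    assert (Cc : continuous (fun t => cos (th t) ^ 2) x).
    { apply (continuous_comp th (fun z => cos z ^ 2)); [apply C |].
      apply @ex_derive_continuous; auto_derive; trivial. }
    assert (Cs : continuous (fun t => sin (th t) ^ 2) x).
    { apply (continuous_comp th (fun z => sin z ^ 2)); [apply C |].
      apply @ex_derive_continuous; auto_derive; trivial. }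
    apply @continuous_plus.
    + apply (continuous_mult p); [apply (co_p_cont _ _ _ _ _ _ _ H) | exact Cc].
    + apply (continuous_mult (fun t => lam * B t - A t)); [| exact Cs].
      apply @continuous_minus; [| apply (co_A_cont _ _ _ _ _ _ _ H)].
      apply (continuous_mult (fun _ => lam)); [apply continuous_const |].
      apply (co_B_cont _ _ _ _ _ _ _ H).
  - exists th; now split; [| split].
Qed.

(** Raising the parameter adds [(l2 - l1) B sin ^ 2 >= 0] to the right-hand side; the remaining
    difference is Lipschitz in the angle and is absorbed by the comparison lemma. *)
Lemma pruefer_angle_mono p A B a b m M l1 l2 th1 th2 :
  coefficients p A B a b m M ->
  pruefer_angle p A B a b l1 th1 -> pruefer_angle p A B a b l2 th2 ->
  l1 <= l2 -> th1 a <= th2 a -> forall x, a <= x <= b -> th1 x <= th2 x.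
Proof.
  intros H [_ D1] [_ D2] l12 Ha x Hx.
  apply Rge_le, Rminus_ge, Rle_ge.
  apply (comparison_le (fun y => th2 y - th1 y)
    (fun y => pruefer p A B l2 y (th2 y) - pruefer p A B l1 y (th1 y))
    (lipschitz_bound l1 M) a b); [| | lra | exact Hx].
  - intros y Hy; apply @is_derive_minus; [now apply D2 | now apply D1].
  - intros y _.
    assert (L := pruefer_lipschitz _ _ _ _ _ _ _ l1 y (th2 y) (th1 y) H).
    apply Rabs_le_between in L.
    assert (pruefer p A B l1 y (th2 y) <= pruefer p A B l2 y (th2 y)).
    { unfold pruefer; assert (hB := co_B _ _ _ _ _ _ _ H y).
      assert (0 <= sin (th2 y) ^ 2) by nra.
      assert (0 <= (l2 - l1) * B y) by nra; nra. }
    lra.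
Qed.

(* Where [sin c = 0] the right-hand side is [p > 0], so the angle crosses the
   level [c] only upwards. *)
Lemma pruefer_angle_cross p A B a b m M lam th c x y :
  coefficients p A B a b m M -> pruefer_angle p A B a b lam th ->
  sin c = 0 -> a <= x -> x < y -> y <= b -> c <= th x -> c < th y.
Proof.
  intros H [_ D] sc ax xy yb cx.
  apply Rlt_0_minus.
  apply (comparison_cross (fun z => th z - c) (fun z => pruefer p A B lam z (th z))
    (lipschitz_bound lam M) x b); [| | lra | lra].
  - intros z Hz.
    replace (pruefer _ _ _ _ _ _) with (pruefer p A B lam z (th z) - 0) by ring.
    apply @is_derive_minus; [apply D; lra | apply @is_derive_const].
  - intros z _.
    assert (L := pruefer_lipschitz _ _ _ _ _ _ _ lam z (th z) c H).
    apply Rabs_le_between in L.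
    assert (pruefer p A B lam z c = p z).
    { unfold pruefer; assert (h := sin2_cos2 c); unfold Rsqr in h.
      replace (cos c ^ 2) with 1 by (rewrite sc in h; lra); rewrite sc; ring. }
    assert (h := co_p _ _ _ _ _ _ _ H z); assert (h' := co_m _ _ _ _ _ _ _ H); lra.
Qed.

Lemma pruefer_angle_pos p A B a b m M lam th x :
  coefficients p A B a b m M -> pruefer_angle p A B a b lam th ->
  0 < th a -> a <= x <= b -> 0 < th x.
Proof.
  intros H Hth Ha Hx.
  destruct (Rle_lt_or_eq_dec a x) as [h | <-]; [lra | | exact Ha].
  apply (pruefer_angle_cross p A B a b m M lam th 0 a x H Hth); try lra.
  apply sin_0.
Qed.

(** At parameter 0 and angle [PI / 2] the right-hand side equals [- A <= 0], so this level cannot be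
    reached from below. This is what puts [g 0] below 0. *)
Lemma pruefer_angle_lt_PI2 p A B a b m M th x :
  coefficients p A B a b m M -> pruefer_angle p A B a b 0 th ->
  th a < PI / 2 -> a <= x <= b -> th x < PI / 2.
Proof.
  intros H [_ D] Ha Hx.
  apply Rlt_0_minus.
  apply (comparison_lt (fun z => PI / 2 - th z) (fun z => - pruefer p A B 0 z (th z))
    (lipschitz_bound 0 M) a b); [| | lra | exact Hx].
  - intros z Hz.
    replace (- pruefer _ _ _ _ _ _) with (0 - pruefer p A B 0 z (th z)) by ring.
    apply @is_derive_minus; [apply @is_derive_const | now apply D].
  - intros z _.
    assert (L := pruefer_lipschitz _ _ _ _ _ _ _ 0 z (PI / 2) (th z) H).
    apply Rabs_le_between in L.
    assert (pruefer p A B 0 z (PI / 2) = - A z).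
    { unfold pruefer; rewrite cos_PI2, sin_PI2; ring. }
    assert (h := co_A _ _ _ _ _ _ _ H z); lra.
Qed.

(** Gronwall for the squared distance of the angles. Adding the constant [(M * (l2 - l1)) ^ 2] to it
    makes the differential inequality homogeneous; the bound yields continuity in the parameter. *)
Lemma pruefer_angle_perturb p A B a b m M l1 l2 th1 th2 :
  coefficients p A B a b m M ->
  pruefer_angle p A B a b l1 th1 -> pruefer_angle p A B a b l2 th2 ->
  (th2 b - th1 b) ^ 2
    <= ((th2 a - th1 a) ^ 2 + (M * (l2 - l1)) ^ 2)
       * exp ((2 * lipschitz_bound l1 M + 1) * (b - a)).
Proof.
  intros H [_ D1] [_ D2].
  apply Rle_trans with ((th2 b - th1 b) ^ 2 + (M * (l2 - l1)) ^ 2).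
  { assert (h := pow2_ge_0 (M * (l2 - l1))); lra. }
  apply (gronwall (fun x => (th2 x - th1 x) ^ 2 + (M * (l2 - l1)) ^ 2)
    (fun x => 2 * (th2 x - th1 x)
       * (pruefer p A B l2 x (th2 x) - pruefer p A B l1 x (th1 x))) _ a b).
  - intros x Hx; auto_derive.
    + split; [| split; [| trivial]]; eexists; [apply (D2 x Hx) | apply (D1 x Hx)].
    + change (Derive (fun y => th2 y) x) with (Derive th2 x).
      change (Derive (fun y => th1 y) x) with (Derive th1 x).
      rewrite (is_derive_unique _ _ _ (D1 x Hx)), (is_derive_unique _ _ _ (D2 x Hx)).
      ring.
  - intros x _.
    assert (L := pruefer_lipschitz _ _ _ _ _ _ _ l1 x (th2 x) (th1 x) H).
    assert (hB := co_B _ _ _ _ _ _ _ H x).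
    set (d := th2 x - th1 x) in *; set (K := lipschitz_bound l1 M) in *.
    set (e := pruefer p A B l1 x (th2 x) - pruefer p A B l1 x (th1 x)) in *.
    set (s := sin (th2 x) ^ 2).
    replace (pruefer p A B l2 x (th2 x) - pruefer p A B l1 x (th1 x))
      with ((l2 - l1) * (B x * s) + e) by (unfold e, s, pruefer; ring).
    assert (hs : 0 <= s <= 1).
    { unfold s; assert (h := sin2_cos2 (th2 x)); unfold Rsqr in h; nra. }
    assert (de : d * e <= K * d ^ 2).
    { apply Rle_trans with (1 := Rle_abs _); rewrite Rabs_mult.
      replace (K * d ^ 2) with (Rabs d * (K * Rabs d)).
      - apply Rmult_le_compat_l; [apply Rabs_pos | exact L].
      - rewrite (Rmult_comm K), <- Rmult_assoc, <- Rabs_mult, Rabs_pos_eq by nra; ring. }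
    assert (bs : 0 <= B x * s <= M) by nra.
    (* From [2 x y <= x ^ 2 + y ^ 2]; this [d ^ 2] is the [+ 1] in the exponent. *)
    assert (2 * d * ((l2 - l1) * (B x * s)) <= d ^ 2 + (M * (l2 - l1)) ^ 2).
    { apply Rle_trans with (d ^ 2 + ((l2 - l1) * (B x * s)) ^ 2).
      - assert (0 <= (d - (l2 - l1) * (B x * s)) ^ 2) by apply pow2_ge_0; lra.
      - apply Rplus_le_compat_l; rewrite Rmult_comm, !(Rpow_mult_distr _ (l2 - l1)).
        apply Rmult_le_compat_r; [apply pow2_ge_0 | apply pow_incr; lra]. }
    assert (0 <= (M * (l2 - l1)) ^ 2) by apply pow2_ge_0.
    assert (0 <= K) by (left; apply (lipschitz_bound_pos _ _ _ _ _ _ _ l1 H)).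
    nra.
  - assert (h := co_ab _ _ _ _ _ _ _ H); lra.
Qed.

(* [z + atan ((k-1) sin z cos z / (cos^2 z + k sin^2 z))] is the branch near [z]
   of [atan (k tan z)]. *)
Lemma is_derive_scaled_angle k z :
  0 < k ->
  is_derive (fun z => z + atan ((k - 1) * sin z * cos z / (cos z ^ 2 + k * sin z ^ 2)))
    z (k / (cos z ^ 2 + k ^ 2 * sin z ^ 2)).
Proof.
  intros kp.
  assert (h := sin2_cos2 z); unfold Rsqr in h.
  assert (h1 : 0 < cos z ^ 2 + k * sin z ^ 2).
  { destruct (Req_dec (sin z) 0) as [E | E]; [rewrite E in *; nra |].
    assert (0 < sin z ^ 2) by (apply pow2_gt_0; exact E); nra. }
  assert (h2 : 0 < cos z ^ 2 + k ^ 2 * sin z ^ 2).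
  { destruct (Req_dec (sin z) 0) as [E | E]; [rewrite E in *; nra |].
    assert (0 < sin z ^ 2) by (apply pow2_gt_0; exact E).
    assert (0 < k ^ 2) by (apply pow2_gt_0; lra); nra. }
  (* With the factor [sin ^ 2 + cos ^ 2] restored, the derivative formula is an identity of rational
     functions in [sin z] and [cos z], which [field] can prove. *)
  replace (k / (cos z ^ 2 + k ^ 2 * sin z ^ 2))
    with (k * (sin z * sin z + cos z * cos z) / (cos z ^ 2 + k ^ 2 * sin z ^ 2))
    by (rewrite h, Rmult_1_r; reflexivity).
  auto_derive; [lra |].
  field; repeat split; try lra.
  apply Rgt_not_eq.
  assert (0 < (cos z ^ 2 + k * sin z ^ 2) ^ 2) by (apply pow_lt; lra).
  assert (0 <= ((k - 1) * sin z * cos z) ^ 2) by apply pow2_ge_0.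
  lra.
Qed.

(** The condition on [lam] gives [th' >= m (cos ^ 2 + k ^ 2 sin ^ 2)], exactly what cancels the
    denominator in the derivative of the rescaled angle [psi]. So [psi] grows at rate at least
    [k m], with [k] at will. As [psi] stays within [PI / 2] of the angle, returning to [th] costs
    one [PI]. *)
Lemma pruefer_angle_growth p A B a b m M lam th c d k e :
  coefficients p A B a b m M -> pruefer_angle p A B a b lam th ->
  a <= c -> c < d -> d <= b -> (forall x, c <= x <= d -> e <= B x) ->
  0 < k -> 0 <= lam -> k ^ 2 * m + M <= lam * e ->
  th c - PI + k * m * (d - c) <= th d.
Proof.
  intros H [_ D] ac cd db He kp lp Hk.
  set (psi := fun z => z + atan ((k - 1) * sin z * cos z / (cos z ^ 2 + k * sin z ^ 2))).
  assert (near : forall z, z - PI / 2 < psi z < z + PI / 2).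
  { intros z; unfold psi.
    assert (h := atan_bound ((k - 1) * sin z * cos z / (cos z ^ 2 + k * sin z ^ 2))); lra. }
  assert (G : psi (th c) - k * m * c <= psi (th d) - k * m * d).
  { apply (nondecreasing_of_derive (fun x => psi (th x) - k * m * x)
      (fun x => pruefer p A B lam x (th x)
         * (k / (cos (th x) ^ 2 + k ^ 2 * sin (th x) ^ 2)) - k * m)); [lra | |].
    - intros x Hx; apply @is_derive_minus.
      + apply (is_derive_comp psi th); [now apply is_derive_scaled_angle | apply D; lra].
      + auto_derive; [trivial | ring].
    - intros x Hx.
      assert (h := sin2_cos2 (th x)); unfold Rsqr in h.
      assert (hk : 0 < k ^ 2) by (apply pow2_gt_0; lra).
      set (w := cos (th x) ^ 2 + k ^ 2 * sin (th x) ^ 2).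
      assert (h2 : 0 < w).
      { unfold w; destruct (Req_dec (sin (th x)) 0) as [E | E]; [rewrite E in *; nra |].
        assert (0 < sin (th x) ^ 2) by (apply pow2_gt_0; exact E); nra. }
      assert (h3 : m * w <= pruefer p A B lam x (th x)).
      { assert (hp := co_p _ _ _ _ _ _ _ H x); assert (hA := co_A _ _ _ _ _ _ _ H x).
        assert (hB := He x Hx).
        assert (lam * e <= lam * B x) by (apply Rmult_le_compat_l; assumption).
        assert (0 <= cos (th x) ^ 2) by apply pow2_ge_0.
        assert (0 <= sin (th x) ^ 2) by apply pow2_ge_0.
        unfold pruefer, w; rewrite Rmult_plus_distr_l; apply Rplus_le_compat.
        - apply Rmult_le_compat_r; lra.
        - rewrite <- Rmult_assoc; apply Rmult_le_compat_r; lra. }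
      replace (k * m) with (m * w * (k / w)) by (field; lra).
      assert (0 < k / w) by (apply Rdiv_lt_0_compat; lra).
      assert (m * w * (k / w) <= pruefer p A B lam x (th x) * (k / w)).
      { apply Rmult_le_compat_r; lra. }
      lra. }
  assert (N1 := near (th c)); assert (N2 := near (th d)); lra.
Qed.

(** Each level [PI, ..., k PI] is attained by the intermediate value theorem, and only once because
    a level reached is exceeded ever after. Levels at or below 0 are excluded by positivity of the
    angle. *)
Lemma pruefer_angle_zeros p A B a b m M lam th k :
  coefficients p A B a b m M -> pruefer_angle p A B a b lam th ->
  0 < th a < PI -> INR k * PI < th b < INR (S k) * PI ->
  exists l, length l = k /\ NoDup l /\
    forall x, In x l <-> a < x < b /\ sin (th x) = 0.
Proof.
  intros H Hth Ha Hb.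
  assert (PI0 := PI_RGT_0).
  assert (ab := co_ab _ _ _ _ _ _ _ H).
  assert (sinN : forall j, sin (INR j * PI) = 0).
  { intros j; apply sin_eq_0_1; exists (Z.of_nat j); now rewrite INR_IZR_INZ. }
  assert (cross := fun j x y => pruefer_angle_cross p A B a b m M lam th (INR j * PI) x y
    H Hth (sinN j)).
  assert (W : forall j, (j <= k)%nat -> exists l, length l = j /\ NoDup l /\
    forall x, In x l <-> a < x < b /\ exists i, (1 <= i <= j)%nat /\ th x = INR i * PI).
  { induction j as [| j IH]; intros jk.
    - exists nil; split; [reflexivity | split; [constructor |]].
      intros x; split; [intros [] | intros [_ [i [hi _]]]; lia].
    - destruct (IH ltac:(lia)) as [l [ll [nd Hl]]].
      assert (j1 : 1 <= INR (S j)) by (apply (le_INR 1); lia).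
      assert (jk' : INR (S j) <= INR k) by (apply le_INR; lia).
      destruct (IVT_gen_consistent th a b (INR (S j) * PI)) as [x [Hx Ex]].
      { apply Hth. }
      { rewrite Rmin_left, Rmax_right by nra; nra. }
      rewrite Rmin_left, Rmax_right in Hx by lra.
      assert (Hx' : a < x < b).
      { split; apply Rnot_le_lt; intros h.
        - replace x with a in Ex by lra; nra.
        - replace x with b in Ex by lra; nra. }
      exists (x :: l); split; [simpl; now rewrite ll | split].
      + constructor; [| exact nd].
        rewrite Hl; intros [_ [i [hi Ei]]].
        rewrite Ex in Ei; apply Rmult_eq_reg_r in Ei; [| lra].
        apply INR_eq in Ei; lia.
      + intros y; simpl; rewrite Hl; split.
        * intros [<- | [hy [i [hi Ei]]]].
          -- split; [exact Hx' |]; exists (S j); split; [lia | exact Ex].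
          -- split; [exact hy |]; exists i; split; [lia | exact Ei].
        * intros [hy [i [hi Ei]]].
          destruct (Nat.eq_dec i (S j)) as [-> | ne].
          -- left; destruct (Rtotal_order x y) as [h | [h | h]]; [| exact h |].
             ++ assert (q := cross (S j) x y); lra.
             ++ assert (q := cross (S j) y x); lra.
          -- right; split; [exact hy |]; exists i; split; [lia | exact Ei]. }
  destruct (W k (le_n k)) as [l [ll [nd Hl]]].
  exists l; split; [exact ll | split; [exact nd |]].
  intros x; rewrite Hl; split.
  - intros [hx [i [_ ->]]]; now split.
  - intros [hx sx]; split; [exact hx |].
    destruct (sin_eq_0_0 _ sx) as [z Ez].
    assert (px := pruefer_angle_pos p A B a b m M lam th x H Hth ltac:(lra) ltac:(lra)).
    assert (z0 : (0 < z)%Z).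
    { apply lt_IZR; rewrite Ez in px; apply Rmult_lt_reg_r with PI; lra. }
    exists (Z.to_nat z).
    assert (Iz : INR (Z.to_nat z) = IZR z).
    { rewrite INR_IZR_INZ, Z2Nat.id by lia; reflexivity. }
    split; [split; [lia |] | now rewrite Iz].
    (* A level [S k * PI] or higher met inside would be exceeded at [b], against the bound on
       [th b]. *)
    apply Nat.nlt_ge; intros h.
    assert (q := cross (S k) x b).
    assert (INR (S k) <= INR (Z.to_nat z)) by (apply le_INR; lia).
    rewrite Iz in *.
    assert (INR (S k) * PI <= th x) by (rewrite Ez; apply Rmult_le_compat_r; lra).
    lra.
Qed.

(** * Locating the eigenvalues *)

Lemma eigenvalue_sequence p A B a b m M h1 k1 h2 k2 (th : R -> R -> R) :
  coefficients p A B a b m M ->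
  (exists c d e, a <= c /\ c < d /\ d <= b /\ 0 < e /\
     forall x, c <= x <= d -> e <= B x) ->
  0 < h1 -> 0 < k1 -> 0 < h2 -> 0 < k2 ->
  (forall lam, th lam a = PI / 2 - atan (h1 - lam * k1)) ->
  (forall lam, pruefer_angle p A B a b lam (th lam)) ->
  exists lam : nat -> R, 0 < lam 0%nat /\ (forall k, lam k < lam (S k)) /\
    (forall k, th (lam k) b = PI / 2 + atan (h2 - lam k * k2) + INR k * PI) /\
    (forall l, sin (th l b - (PI / 2 + atan (h2 - l * k2))) = 0 ->
       exists k, l = lam k).
Proof.
  intros H [c [d [e [ac [cd [db [e0 He]]]]]]] h10 k10 h20 k20 Ha Hth.
  assert (PI0 := PI_RGT_0).
  assert (ab := co_ab _ _ _ _ _ _ _ H); assert (m0 := co_m _ _ _ _ _ _ _ H).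
  assert (M0 : 0 < M) by (assert (h := co_p _ _ _ _ _ _ _ H 0); lra).
  set (g := fun l => th l b - (PI / 2 + atan (h2 - l * k2))).
  (* The angle contributes a weak inequality; strictness is due to the target, which decreases
     because [k2 > 0]. *)
  assert (ginc : forall l1 l2, l1 < l2 -> g l1 < g l2).
  { intros l1 l2 h; unfold g.
    assert (th l1 b <= th l2 b).
    { apply (pruefer_angle_mono p A B a b m M l1 l2 (th l1) (th l2) H (Hth l1) (Hth l2));
        [lra | | lra].
      rewrite !Ha; assert (atan (h1 - l2 * k1) < atan (h1 - l1 * k1))
        by (apply atan_increasing; nra); lra. }
    assert (atan (h2 - l2 * k2) < atan (h2 - l1 * k2)) by (apply atan_increasing; nra).
    lra. }
  assert (gcont : forall l, continuous g l).
  { intros l; unfold g; apply @continuous_minus.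
    2:{ apply @ex_derive_continuous; auto_derive; trivial. }
    set (E := exp ((2 * lipschitz_bound l M + 1) * (b - a))).
    assert (E0 : 0 < E) by apply exp_pos.
    (* The squared difference is at most [(C - 1) * (l' - l) ^ 2], and [C - 1 <= C ^ 2] since
       [C >= 1]; so [C] is a Lipschitz constant at [l], found without a square root. *)
    set (C := 1 + (k1 ^ 2 + M ^ 2) * E).
    assert (C1 : 1 <= C).
    { unfold C; assert (0 <= (k1 ^ 2 + M ^ 2) * E) by (apply Rmult_le_pos; nra); lra. }
    assert (Lip : forall l', Rabs (th l' b - th l b) <= C * Rabs (l' - l)).
    { intros l'.
      assert (Q := pruefer_angle_perturb p A B a b m M l l' (th l) (th l') H (Hth l) (Hth l')).
      fold E in Q.
      assert (Qa : (th l' a - th l a) ^ 2 <= (k1 * (l' - l)) ^ 2).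
      { rewrite !Ha.
        assert (q := atan_lipschitz (h1 - l * k1) (h1 - l' * k1)).
        replace (h1 - l * k1 - (h1 - l' * k1)) with (k1 * (l' - l)) in q by ring.
        apply Rsqr_le_abs_1 in q; unfold Rsqr in q; nra. }
      rewrite <- (Rabs_pos_eq C) by lra; rewrite <- Rabs_mult.
      apply Rsqr_le_abs_0; unfold Rsqr.
      apply Rle_trans with ((k1 ^ 2 + M ^ 2) * E * (l' - l) ^ 2).
      - apply Rle_trans with
          (((k1 * (l' - l)) ^ 2 + (M * (l' - l)) ^ 2) * E); [| right; ring].
        apply Rle_trans with (((th l' a - th l a) ^ 2 + (M * (l' - l)) ^ 2) * E);
          [lra |].
        apply Rmult_le_compat_r; lra.
      - replace (C * (l' - l) * (C * (l' - l))) with (C * C * (l' - l) ^ 2) by ring.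
        apply Rmult_le_compat_r; [apply pow2_ge_0 |].
        assert (C <= C * C) by nra; unfold C in *; lra. }
    apply (continuous_of_eps (fun l => th l b)); intros eps ep.
    exists (eps / C); split; [apply Rdiv_lt_0_compat; lra |].
    intros y Hy; apply Rle_lt_trans with (1 := Lip y).
    rewrite Rmult_comm; apply (Rlt_div_r (Rabs (y - l)) eps C); lra. }
  assert (g0 : g 0 < 0).
  { unfold g.
    assert (th 0 b < PI / 2).
    { apply (pruefer_angle_lt_PI2 p A B a b m M _ b H (Hth 0)); [| lra].
      rewrite Ha; assert (atan 0 < atan (h1 - 0 * k1)) by (apply atan_increasing; lra).
      rewrite atan_0 in *; lra. }
    assert (atan 0 < atan (h2 - 0 * k2)) by (apply atan_increasing; lra).
    rewrite atan_0 in *; lra. }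
  assert (gneg : forall l, - PI < g l).
  { intros l; unfold g.
    assert (0 < th l b).
    { apply (pruefer_angle_pos p A B a b m M l _ b H (Hth l)); [| lra].
      rewrite Ha; assert (q := atan_bound (h1 - l * k1)); lra. }
    assert (q := atan_bound (h2 - l * k2)); lra. }
  assert (gbig : forall k : nat, exists l, 0 < l /\ INR k * PI <= g l).
  { intros k.
    (* Chosen to make the gain on [[c, d]] equal to [(k + 2) PI]: one [PI] is lost to the rescaling,
       another to the target, which is below [PI]. The [l] below turns the condition of the growth
       lemma into an equality. *)
    set (K := (INR k + 2) * PI / (m * (d - c))).
    assert (k0 := pos_INR k).
    assert (K0 : 0 < K).
    { unfold K; apply Rdiv_lt_0_compat; apply Rmult_lt_0_compat; lra. }
    set (l := (K ^ 2 * m + M) / e).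
    assert (l0 : 0 < l).
    { unfold l; apply Rdiv_lt_0_compat; [| exact e0].
      assert (0 < K ^ 2) by (apply pow_lt; exact K0); nra. }
    exists l; split; [exact l0 |].
    assert (Q := pruefer_angle_growth p A B a b m M l (th l) c d K e H (Hth l) ac cd db He
      K0 (Rlt_le _ _ l0)).
    assert (Q1 : th l c - PI + K * m * (d - c) <= th l d).
    { apply Q; unfold l; right; field; lra. }
    replace (K * m * (d - c)) with ((INR k + 2) * PI) in Q1 by (unfold K; field; lra).
    assert (thc : 0 < th l c).
    { apply (pruefer_angle_pos p A B a b m M l _ c H (Hth l)); [| lra].
      rewrite Ha; assert (q := atan_bound (h1 - l * k1)); lra. }
    assert (thb : INR (S k) * PI <= th l b).
    { rewrite S_INR.
      (* Beyond [d] the angle may decrease, but not below a multiple of [PI] already reached. *)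
      destruct (Rle_lt_or_eq_dec d b db) as [h | <-]; [| nra].
      left; apply (pruefer_angle_cross p A B a b m M l (th l) _ d b H (Hth l));
        try lra; try nra.
      apply sin_eq_0_1; exists (Z.of_nat (S k)); rewrite <- INR_IZR_INZ, S_INR; reflexivity. }
    rewrite S_INR in thb; unfold g.
    assert (q := atan_bound (h2 - l * k2)); lra. }
  assert (ex : forall k : nat, exists l, 0 < l /\ g l = INR k * PI).
  { intros k; destruct (gbig k) as [L [L0 HL]].
    assert (k0 := pos_INR k).
    destruct (IVT_gen_consistent g 0 L (INR k * PI) gcont) as [l [Hl El]].
    - assert (0 <= INR k * PI) by nra.
      rewrite Rmin_left, Rmax_right by lra; lra.
    - rewrite Rmin_left, Rmax_right in Hl by lra.
      exists l; split; [| exact El].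
      apply Rnot_le_lt; intros h; replace l with 0 in El by lra; nra. }
  set (lam := fun k => proj1_sig (constructive_indefinite_description _ (ex k))).
  assert (Hlam : forall k, 0 < lam k /\ g (lam k) = INR k * PI).
  { intros k; unfold lam; now destruct (constructive_indefinite_description _ _). }
  assert (ginj : forall l1 l2, g l1 <= g l2 -> l1 <= l2).
  { intros l1 l2 h; apply Rnot_lt_le; intros h'; apply ginc in h'; lra. }
  exists lam; split; [apply Hlam | split; [| split]].
  - intros k; apply Rnot_le_lt; intros h.
    assert (q : g (lam (S k)) <= g (lam k)).
    { destruct (Rle_lt_or_eq_dec _ _ h) as [h' | ->]; [left; now apply ginc | lra]. }
    rewrite (proj2 (Hlam k)), (proj2 (Hlam (S k))), S_INR in q; nra.
  - intros k; assert (h := proj2 (Hlam k)); unfold g in h; lra.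
  - intros l h; destruct (sin_eq_0_0 _ h) as [z Ez]; fold (g l) in Ez.
    (* [g > - PI] everywhere, so only multiples [z PI] with [z >= 0] occur and the sequence misses
       no eigenvalue. *)
    assert (z0 : (-1 < z)%Z).
    { apply lt_IZR; apply Rmult_lt_reg_r with PI; [lra |].
      rewrite <- Ez; assert (q := gneg l); lra. }
    exists (Z.to_nat z).
    assert (E : g l = g (lam (Z.to_nat z))).
    { rewrite (proj2 (Hlam _)), INR_IZR_INZ, Z2Nat.id by lia; exact Ez. }
    apply Rle_antisym; apply ginj; lra.
Qed.

(** * First-order systems *)

(** The point may be an endpoint, so the difference quotient is tested with a small [h] pointing
    towards the farther end; a negative [l] would make that quotient negative. *)
Lemma derive_nonneg_of_monotone (g : R -> R) (a b x l : R) :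
  a < b -> a <= x <= b ->
  (forall y z, a <= y -> y <= z -> z <= b -> g y <= g z) ->
  is_derive g x l -> 0 <= l.
Proof.
  intros ab Hx Hg D; apply Rnot_lt_le; intros l0.
  apply is_derive_Reals in D.
  destruct (D (- l) ltac:(lra)) as [[d dp] Hd]; simpl in Hd.
  assert (E : exists h, h <> 0 /\ Rabs h < d /\ a <= x + h <= b).
  { set (e := Rmin (d / 2) ((b - a) / 2)).
    assert (e1 : e <= d / 2) by apply Rmin_l.
    assert (e2 : e <= (b - a) / 2) by apply Rmin_r.
    assert (e0 : 0 < e) by (apply Rmin_glb_lt; lra).
    destruct (Rle_dec x ((a + b) / 2)) as [h | h].
    - exists e; rewrite Rabs_pos_eq by lra; repeat split; lra.
    - exists (- e); rewrite Rabs_left by lra; repeat split; lra. }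
  destruct E as [h [h0 [hd hx]]].
  specialize (Hd h h0 hd).
  assert (0 <= (g (x + h) - g x) / h).
  { destruct (Rle_dec 0 h) as [hp | hn].
    - assert (g x <= g (x + h)) by (apply Hg; lra).
      apply Rdiv_le_0_compat; lra.
    - assert (g (x + h) <= g x) by (apply Hg; lra).
      replace ((g (x + h) - g x) / h) with ((g x - g (x + h)) / (- h)) by (field; lra).
      apply Rdiv_le_0_compat; lra. }
  apply Rabs_lt_between in Hd; lra.
Qed.

(** [f - g] and [g - f] vanish on the interval, hence both are monotone there. The point of interest
    is an endpoint, where two-sided derivatives also see values outside. *)
Lemma derive_eq_of_eq_on (f g : R -> R) (a b x l k : R) :
  a < b -> a <= x <= b -> (forall y, a <= y <= b -> f y = g y) ->
  is_derive f x l -> is_derive g x k -> l = k.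
Proof.
  intros ab Hx E Df Dg.
  assert (0 <= l - k).
  { apply (derive_nonneg_of_monotone (fun y => f y - g y) a b x); try assumption.
    - intros y z H1 H2 H3; rewrite !E by lra; lra.
    - now apply @is_derive_minus. }
  assert (0 <= k - l).
  { apply (derive_nonneg_of_monotone (fun y => g y - f y) a b x); try assumption.
    - intros y z H1 H2 H3; rewrite !E by lra; lra.
    - now apply @is_derive_minus. }
  lra.
Qed.

(* The equation holds on the open interval only, but [P u'] and hence [u']
   extend to C^1 and C^0 functions on the whole line. *)
Lemma first_order_form (P p h u : R -> R) (a b : R) :
  a < b -> (forall x, continuous p x) -> (forall x, continuous h x) ->
  (forall x, a <= x <= b -> P x * p x = 1) ->
  (forall x, a <= x <= b -> ex_derive u x) ->
  (forall x, a < x < b -> is_derive (fun y => P y * Derive u y) x (h x)) ->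
  exists U W, (forall x, is_derive U x (p x * W x)) /\
    (forall x, is_derive W x (h x)) /\
    forall x, a <= x <= b ->
      u x = U x /\ P x * Derive u x = W x /\ Derive u x = p x * W x.
Proof.
  intros ab Cp Ch Pp Du Dw.
  set (c := (a + b) / 2).
  (* The constant of integration is read at the midpoint, because the equation is available only
     inside the interval. *)
  set (W := fun x => P c * Derive u c + RInt h c x).
  assert (DW : forall x, is_derive W x (h x)).
  { intros x; replace (h x) with (0 + h x) by ring.
    apply @is_derive_plus; [apply @is_derive_const | now apply is_derive_RInt_continuous]. }
  assert (EW : forall x, a < x < b -> P x * Derive u x = W x).
  { assert (D0 : forall x, a < x < b -> is_derive (fun y => P y * Derive u y - W y) x 0).
    { intros x Hx; replace 0 with (h x - h x) by ring.
      apply @is_derive_minus; [now apply Dw | apply DW]. }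
    assert (Wc : W c = P c * Derive u c).
    { unfold W; rewrite RInt_point; apply Rplus_0_r. }
    intros x Hx; unfold c in *.
    destruct (Rle_dec ((a + b) / 2) x) as [l | l].
    - assert (Q := constant_of_derive _ ((a + b) / 2) x
        (fun y Hy => D0 y ltac:(lra)) x ltac:(lra)); simpl in Q; lra.
    - assert (Q := constant_of_derive _ x ((a + b) / 2)
        (fun y Hy => D0 y ltac:(lra)) ((a + b) / 2) ltac:(lra)); simpl in Q; lra. }
  assert (CW : forall x, continuous (fun y => p y * W y) x).
  { intros x; apply (continuous_mult p W); [apply Cp |].
    apply @ex_derive_continuous; eexists; apply DW. }
  set (U := fun x => u a + RInt (fun y => p y * W y) a x).
  assert (DU : forall x, is_derive U x (p x * W x)).
  { intros x; replace (p x * W x) with (0 + p x * W x) by ring.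
    apply @is_derive_plus; [apply @is_derive_const |].
    now apply (is_derive_RInt_continuous (fun y => p y * W y)). }
  assert (EU : forall x, a <= x <= b -> u x = U x).
  { intros x Hx.
    (* The derivative of [u - U] is known to vanish only inside; continuity up to the ends is what
       the mean value theorem asks in addition, and it gives equality on the closed interval. *)
    destruct (MVT_gen (fun y => u y - U y) a x (fun _ => 0)) as [z [_ Ez]];
      rewrite ?Rmin_left, ?Rmax_right by lra.
    - intros y Hy.
      replace 0 with (Derive u y - p y * W y).
      + apply @is_derive_minus; [apply Derive_correct, Du; lra | apply DU].
      + rewrite <- EW by lra; rewrite <- Rmult_assoc, (Rmult_comm (p y)), Pp by lra; ring.
    - intros y Hy; apply continuity_pt_filterlim.
      apply (continuous_minus u U); apply @ex_derive_continuous;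
        [apply Du; lra | eexists; apply DU].
    - assert (Ua : U a = u a) by (unfold U; rewrite RInt_point; apply Rplus_0_r).
      simpl in Ez; lra. }
  exists U, W; split; [exact DU | split; [exact DW |]].
  intros x Hx.
  assert (E : Derive u x = p x * W x).
  { apply (derive_eq_of_eq_on u U a b x _ _ ab Hx EU); [| apply DU].
    now apply Derive_correct, Du. }
  split; [now apply EU | split; [| exact E]].
  rewrite E, <- Rmult_assoc, Pp by exact Hx; ring.
Qed.

Lemma is_derive_mult_R (f g : R -> R) (x f' g' : R) :
  is_derive f x f' -> is_derive g x g' ->
  is_derive (fun y => f y * g y) x (f' * g x + f x * g').
Proof.
  intros Hf Hg; apply (is_derive_mult f g x f' g' Hf Hg); intros; apply Rmult_comm.
Qed.

Lemma is_derive_value (f : R -> R) (x l l' : R) :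
  is_derive f x l -> l = l' -> is_derive f x l'.
Proof. now intros H <-. Qed.

(** The Wronskian is constant, hence zero, so [(u, w)] is parallel to [(phi, omega)]. The factor is
    taken as the projection [(u phi + w omega) / (phi ^ 2 + omega ^ 2)], which has no poles at zeros
    of [phi]; its derivative contains the Wronskian as a factor. *)
Lemma proportional_solutions (p q u w phi omega : R -> R) (a b : R) :
  (forall x, a <= x <= b -> is_derive u x (p x * w x) /\ is_derive w x (q x * u x)) ->
  (forall x, a <= x <= b ->
     is_derive phi x (p x * omega x) /\ is_derive omega x (q x * phi x)) ->
  (forall x, a <= x <= b -> 0 < phi x ^ 2 + omega x ^ 2) ->
  u a * omega a - w a * phi a = 0 ->
  exists C, forall x, a <= x <= b -> u x = C * phi x /\ w x = C * omega x.
Proof.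
  intros Hu Hphi Hpos Ha.
  assert (Wr : forall x, a <= x <= b -> u x * omega x - w x * phi x = 0).
  { intros x Hx; rewrite <- Ha.
    apply (constant_of_derive (fun y => u y * omega y - w y * phi y) a b);
      [| exact Hx].
    intros y Hy; destruct (Hu y Hy) as [du dw], (Hphi y Hy) as [dphi domega].
    eapply is_derive_value.
    - apply @is_derive_minus; apply is_derive_mult_R; eassumption.
    - simpl; unfold minus, plus, opp; simpl; ring. }
  set (N := fun y => u y * phi y + w y * omega y).
  set (D := fun y => phi y * phi y + omega y * omega y).
  assert (D0 : forall x, a <= x <= b -> D x <> 0).
  { intros x Hx; assert (h := Hpos x Hx); unfold D; simpl in h; nra. }
  assert (Q : forall x, a <= x <= b -> N x / D x = N a / D a).
  { apply (constant_of_derive (fun x => N x / D x)); intros y Hy.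
    destruct (Hu y Hy) as [du dw], (Hphi y Hy) as [dphi domega].
    assert (dN : is_derive N y (p y * w y * phi y + u y * (p y * omega y)
                    + (q y * u y * omega y + w y * (q y * phi y)))).
    { apply @is_derive_plus; apply is_derive_mult_R; assumption. }
    assert (dD : is_derive D y (p y * omega y * phi y + phi y * (p y * omega y)
                    + (q y * phi y * omega y + omega y * (q y * phi y)))).
    { apply @is_derive_plus; apply is_derive_mult_R; assumption. }
    eapply is_derive_value; [apply (is_derive_div N D y _ _ dN dD), D0, Hy |].
    assert (E := Wr y Hy); assert (d0 := D0 y Hy).
    apply Rmult_eq_reg_r with (D y ^ 2); [| now apply pow_nonzero].
    unfold Rdiv; rewrite Rmult_assoc, Rinv_l by (now apply pow_nonzero).
    unfold N, D.
    transitivity ((p y + q y) * ((w y * phi y - u y * omega y)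
                    * (phi y ^ 2 - omega y ^ 2))); [ring |].
    replace (w y * phi y - u y * omega y) with 0 by lra; ring. }
  exists (N a / D a); intros x Hx; rewrite <- (Q x Hx).
  assert (E := Wr x Hx); assert (d0 := D0 x Hx); unfold N, D in *.
  split; apply Rmult_eq_reg_r with (phi x * phi x + omega x * omega x); try exact d0;
    unfold Rdiv.
  - transitivity (phi x * (u x * phi x + w x * omega x) +
      omega x * (u x * omega x - w x * phi x)); [ring | rewrite E; field; exact d0].
  - transitivity (omega x * (u x * phi x + w x * omega x) -
      phi x * (u x * omega x - w x * phi x)); [ring | rewrite E; field; exact d0].
Qed.

(** Given the phase, the amplitude obeys the linear equation [r' = (p + A - lam B) sin th cos th r],
    solved by the exponential of an integral. *)
Lemma pruefer_solution p A B a b m M lam th :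
  coefficients p A B a b m M -> pruefer_angle p A B a b lam th ->
  exists r : R -> R, (forall x, 0 < r x) /\ forall x, a <= x <= b ->
    is_derive (fun y => r y * sin (th y)) x (p x * (r x * cos (th x))) /\
    is_derive (fun y => r y * cos (th y)) x ((A x - B x * lam) * (r x * sin (th x))).
Proof.
  intros H [Cth Dth].
  set (f := fun x => (p x + (A x - B x * lam)) * (sin (th x) * cos (th x))).
  assert (Cf : forall x, continuous f x).
  { intros x; apply (continuous_mult (fun x => p x + (A x - B x * lam))).
    - apply (continuous_plus p); [apply (co_p_cont _ _ _ _ _ _ _ H) |].
      apply (continuous_minus A); [apply (co_A_cont _ _ _ _ _ _ _ H) |].
      apply (continuous_mult B); [apply (co_B_cont _ _ _ _ _ _ _ H) | apply continuous_const].
    - apply (continuous_comp th (fun z => sin z * cos z)); [apply Cth |].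
      apply @ex_derive_continuous; auto_derive; trivial. }
  exists (fun x => exp (RInt f a x)); split; [intros x; apply exp_pos |].
  intros x Hx.
  assert (Dr : is_derive (fun y => exp (RInt f a y)) x (f x * exp (RInt f a x))).
  { apply (is_derive_comp exp (fun y => RInt f a y)); [apply is_derive_exp |].
    now apply is_derive_RInt_continuous. }
  assert (Ds : is_derive (fun y => sin (th y)) x
                 (pruefer p A B lam x (th x) * cos (th x))).
  { apply (is_derive_comp sin th); [apply is_derive_sin | now apply Dth]. }
  assert (Dc : is_derive (fun y => cos (th y)) x
                 (pruefer p A B lam x (th x) * - sin (th x))).
  { apply (is_derive_comp cos th); [apply is_derive_cos | now apply Dth]. }
  assert (h := sin2_cos2 (th x)); unfold Rsqr in h.
  split; eapply is_derive_value; try (apply is_derive_mult_R; eassumption).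
  - unfold f, pruefer; set (R := exp _).
    transitivity (p x * (R * cos (th x)) *
      (sin (th x) * sin (th x) + cos (th x) * cos (th x))); [ring | rewrite h; ring].
  - unfold f, pruefer; set (R := exp _).
    transitivity ((A x - B x * lam) * (R * sin (th x)) *
      (sin (th x) * sin (th x) + cos (th x) * cos (th x))); [ring | rewrite h; ring].
Qed.

(* [lb (W V - U Z)] is nondecreasing, nonnegative at [a] and nonpositive at [b];
   so the solution has zero initial data at [a]. *)
Lemma nonreal_parameter_trivial p A B a b m M h1 k1 h2 k2 la lb (U W V Z : R -> R) :
  coefficients p A B a b m M -> 0 < k1 -> 0 < k2 -> lb <> 0 ->
  (forall x, a <= x <= b -> is_derive U x (p x * W x) /\
     is_derive W x ((A x - B x * la) * U x + B x * lb * V x)) ->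
  (forall x, a <= x <= b -> is_derive V x (p x * Z x) /\
     is_derive Z x ((A x - B x * la) * V x - B x * lb * U x)) ->
  W a = (h1 - la * k1) * U a + lb * k1 * V a ->
  Z a = (h1 - la * k1) * V a - lb * k1 * U a ->
  W b = - ((h2 - la * k2) * U b + lb * k2 * V b) ->
  Z b = - ((h2 - la * k2) * V b - lb * k2 * U b) ->
  forall x, a <= x <= b -> U x = 0 /\ V x = 0.
Proof.
  intros H k10 k20 lb0 DU DV Wa Za Wb Zb.
  assert (ab := co_ab _ _ _ _ _ _ _ H).
  assert (lb2 : 0 < lb ^ 2) by (now apply pow2_gt_0).
  (* The terms with [p] and [A - B la] cancel in the derivative of [W V - U Z], leaving
     [lb B (U ^ 2 + V ^ 2)]; the outer [lb] makes the sign independent of that of [lb]. *)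
  assert (G : lb * (W a * V a - U a * Z a) <= lb * (W b * V b - U b * Z b)).
  { apply (nondecreasing_of_derive (fun x => lb * (W x * V x - U x * Z x))
      (fun x => lb ^ 2 * (B x * (U x ^ 2 + V x ^ 2)))); [lra | |].
    - intros x Hx; destruct (DU x Hx) as [dU dW], (DV x Hx) as [dV dZ].
      eapply is_derive_value.
      + apply is_derive_mult_R; [apply @is_derive_const |].
        apply @is_derive_minus; apply is_derive_mult_R; eassumption.
      + simpl; unfold minus, plus, opp, zero; simpl; ring.
    - intros x Hx; assert (h := co_B _ _ _ _ _ _ _ H x).
      apply Rmult_le_pos; [lra |]; apply Rmult_le_pos; [lra |]; nra. }
  assert (S : U a ^ 2 + V a ^ 2 = 0).
  { assert (0 <= U b ^ 2 + V b ^ 2) by nra.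
    assert (0 <= U a ^ 2 + V a ^ 2) by nra.
    rewrite Wa, Za, Wb, Zb in G.
    assert (G' : lb ^ 2 * k1 * (U a ^ 2 + V a ^ 2) <= - (lb ^ 2 * k2 * (U b ^ 2 + V b ^ 2)))
      by nra.
    assert (0 < lb ^ 2 * k1) by nra.
    assert (0 <= lb ^ 2 * k2 * (U b ^ 2 + V b ^ 2)) by (apply Rmult_le_pos; nra).
    nra. }
  assert (Ua : U a = 0) by nra.
  assert (Va : V a = 0) by nra.
  rewrite Ua, Va in Wa, Za.
  (* Zero data propagate by Gronwall for this energy: each doubled product in its derivative is at
     most [E], and [N] collects bounds of their coefficients. *)
  set (E := fun x => U x * U x + V x * V x + (W x * W x + Z x * Z x)).
  set (N := 2 * M + Rabs la * M + Rabs lb * M).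
  intros x Hx.
  assert (Ex : E x <= E a * exp (N * (x - a))).
  { apply (gronwall E (fun y => 2 * ((p y + (A y - B y * la)) * (U y * W y + V y * Z y)
      + B y * lb * (V y * W y - U y * Z y))) N a b); [| | exact Hx].
    - intros y Hy; destruct (DU y Hy) as [dU dW], (DV y Hy) as [dV dZ].
      eapply is_derive_value.
      + apply @is_derive_plus; apply @is_derive_plus; apply is_derive_mult_R; eassumption.
      + simpl; unfold plus; simpl; ring.
    - intros y Hy.
      assert (hp := co_p _ _ _ _ _ _ _ H y); assert (hA := co_A _ _ _ _ _ _ _ H y).
      assert (hB := co_B _ _ _ _ _ _ _ H y); assert (hm := co_m _ _ _ _ _ _ _ H).
      assert (b1 : Rabs (B y * la) <= Rabs la * M).
      { rewrite Rabs_mult, (Rabs_pos_eq (B y)), Rmult_comm by lra.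
        apply Rmult_le_compat_l; [apply Rabs_pos | lra]. }
      assert (b2 : Rabs (B y * lb) <= Rabs lb * M).
      { rewrite Rabs_mult, (Rabs_pos_eq (B y)), Rmult_comm by lra.
        apply Rmult_le_compat_l; [apply Rabs_pos | lra]. }
      assert (prod : forall c C X Y, Rabs c <= C -> Rabs X <= Y -> c * X <= C * Y).
      { intros c C X Y h h'; apply Rle_trans with (1 := Rle_abs _).
        rewrite Rabs_mult; apply Rmult_le_compat; try apply Rabs_pos; assumption. }
      assert (s1 : Rabs (2 * (U y * W y + V y * Z y)) <= E y).
      { unfold E; apply Rabs_le_between.
        assert (q1 := pow2_ge_0 (U y - W y)); assert (q2 := pow2_ge_0 (U y + W y)).
        assert (q3 := pow2_ge_0 (V y - Z y)); assert (q4 := pow2_ge_0 (V y + Z y)); lra. }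
      assert (s2 : Rabs (2 * (V y * W y - U y * Z y)) <= E y).
      { unfold E; apply Rabs_le_between.
        assert (q1 := pow2_ge_0 (V y - W y)); assert (q2 := pow2_ge_0 (V y + W y)).
        assert (q3 := pow2_ge_0 (U y - Z y)); assert (q4 := pow2_ge_0 (U y + Z y)); lra. }
      assert (b3 : Rabs (p y + (A y - B y * la)) <= 2 * M + Rabs la * M).
      { apply Rabs_le_between in b1; apply Rabs_le_between; lra. }
      assert (t1 := prod _ _ _ _ b3 s1); assert (t2 := prod _ _ _ _ b2 s2).
      unfold N; lra. }
  replace (E a) with 0 in Ex by (unfold E; rewrite Wa, Za, Ua, Va; ring).
  unfold E in Ex; nra.
Qed.

(** For [f = u + i v] and complex [lambda], the end conditions are [P f' = (h1 - lambda k1) f] at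
    [a] and [P f' = - (h2 - lambda k2) f] at [b]. They are written for [P f'], the second unknown of
    the first-order system. *)
Definition eigenfunction (P A B : R -> R) (a b h1 k1 h2 k2 la lb : R) (u v : R -> R) : Prop :=
  (forall z, a <= z <= b -> ex_derive u z /\ ex_derive v z) /\
  (forall z, a < z < b ->
     is_derive (fun y => P y * Derive u y) z
       ((A z - B z * la) * u z + B z * lb * v z) /\
     is_derive (fun y => P y * Derive v y) z
       ((A z - B z * la) * v z - B z * lb * u z)) /\
  P a * Derive u a = (h1 - la * k1) * u a + lb * k1 * v a /\
  P a * Derive v a = (h1 - la * k1) * v a - lb * k1 * u a /\
  P b * Derive u b = - ((h2 - la * k2) * u b + lb * k2 * v b) /\
  P b * Derive v b = - ((h2 - la * k2) * v b - lb * k2 * u b) /\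
  (exists z, a <= z <= b /\ (u z <> 0 \/ v z <> 0)).

Lemma eigenfunction_first_order P A B p a b h1 k1 h2 k2 la lb u v :
  a < b -> cont_on A a b -> cont_on B a b -> (forall x, continuous p x) ->
  (forall x, a <= x <= b -> P x * p x = 1) ->
  eigenfunction P A B a b h1 k1 h2 k2 la lb u v ->
  exists U W V Z,
    (forall x, is_derive U x (p x * W x)) /\ (forall x, ex_derive W x) /\
    (forall x, is_derive V x (p x * Z x)) /\ (forall x, ex_derive Z x) /\
    (forall x, a <= x <= b ->
       is_derive W x ((A x - B x * la) * U x + B x * lb * V x) /\
       is_derive Z x ((A x - B x * la) * V x - B x * lb * U x)) /\
    (forall x, a <= x <= b ->
       (u x = U x /\ P x * Derive u x = W x /\ Derive u x = p x * W x) /\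
       (v x = V x /\ P x * Derive v x = Z x /\ Derive v x = p x * Z x)).
Proof.
  intros ab CA CB Cp Pp [Hd [He _]].
  assert (Cu : cont_on u a b).
  { apply cont_on_continuous; intros x Hx; apply @ex_derive_continuous, Hd, Hx. }
  assert (Cv : cont_on v a b).
  { apply cont_on_continuous; intros x Hx; apply @ex_derive_continuous, Hd, Hx. }
  assert (Cc : forall g, cont_on g a b -> forall x, continuous (fun y => g (clamp a b y)) x).
  { intros g Cg x; apply continuous_clamp; [lra | exact Cg]. }
  assert (Cq : forall x, continuous (fun y => A (clamp a b y) - B (clamp a b y) * la) x).
  { intros x; apply (continuous_minus (fun y => A (clamp a b y))); [now apply Cc |].
    apply (continuous_mult (fun y => B (clamp a b y))); [now apply Cc |].
    apply continuous_const. }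
  assert (Cb : forall x, continuous (fun y => B (clamp a b y) * lb) x).
  { intros x; apply (continuous_mult (fun y => B (clamp a b y))); [now apply Cc |].
    apply continuous_const. }
  set (h := fun x => (A (clamp a b x) - B (clamp a b x) * la) * u (clamp a b x)
                     + B (clamp a b x) * lb * v (clamp a b x)).
  set (k := fun x => (A (clamp a b x) - B (clamp a b x) * la) * v (clamp a b x)
                     - B (clamp a b x) * lb * u (clamp a b x)).
  destruct (first_order_form P p h u a b) as [U [W [DU [DW EU]]]]; try assumption.
  { intros x; unfold h.
    apply (continuous_plus (fun x => (A (clamp a b x) - B (clamp a b x) * la)
                                       * u (clamp a b x))).
    - now apply (continuous_mult _ (fun x => u (clamp a b x)));
        [apply Cq | apply Cc].
    - now apply (continuous_mult _ (fun x => v (clamp a b x)));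
        [apply Cb | apply Cc]. }
  { intros x Hx; now apply Hd. }
  { intros x Hx; unfold h; rewrite clamp_id by lra; now apply He. }
  destruct (first_order_form P p k v a b) as [V [Z [DV [DZ EV]]]]; try assumption.
  { intros x; unfold k.
    apply (continuous_minus (fun x => (A (clamp a b x) - B (clamp a b x) * la)
                                       * v (clamp a b x))).
    - now apply (continuous_mult _ (fun x => v (clamp a b x)));
        [apply Cq | apply Cc].
    - now apply (continuous_mult _ (fun x => u (clamp a b x)));
        [apply Cb | apply Cc]. }
  { intros x Hx; now apply Hd. }
  { intros x Hx; unfold k; rewrite clamp_id by lra; now apply He. }
  exists U, W, V, Z.
  split; [exact DU | split; [intros x; eexists; apply DW |]].
  split; [exact DV | split; [intros x; eexists; apply DZ |]].
  split.
  - intros x Hx; rewrite <- (proj1 (EU x Hx)), <- (proj1 (EV x Hx)).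
    assert (dW := DW x); assert (dZ := DZ x); unfold h, k in dW, dZ.
    rewrite (clamp_id a b x Hx) in dW, dZ; now split.
  - intros x Hx; split; [now apply EU | now apply EV].
Qed.

(** * Eigenvalues and eigenfunctions *)

Lemma cos_atan_pos x : 0 < cos (atan x).
Proof. assert (c := atan_bound x); apply cos_gt_0; lra. Qed.

Lemma sin_atan_mul_cos x : sin (atan x) = x * cos (atan x).
Proof.
  assert (h := tan_atan x); unfold tan in h.
  assert (c := cos_atan_pos x).
  rewrite <- h at 2; field; lra.
Qed.

(** As [cos (atan t) > 0], the phase meets its target modulo [PI] exactly when the right-hand
    boundary condition [cos z = - t sin z] holds. *)
Lemma sin_minus_shifted_atan z t :
  sin (z - (PI / 2 + atan t)) = - cos (atan t) * (cos z + t * sin z).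
Proof.
  rewrite sin_minus, sin_plus, cos_plus, sin_PI2, cos_PI2, sin_atan_mul_cos; ring.
Qed.

Lemma coefficients_clamp (P A B : R -> R) (a b : R) :
  a < b -> cont_on P a b -> cont_on A a b -> cont_on B a b ->
  (forall x, a <= x <= b -> 0 < P x) ->
  (forall x, a <= x <= b -> 0 <= A x) -> (forall x, a <= x <= b -> 0 <= B x) ->
  exists m M, coefficients (fun x => / P (clamp a b x)) (fun x => A (clamp a b x))
    (fun x => B (clamp a b x)) a b m M.
Proof.
  intros ab CP CA CB P0 A0 B0.
  assert (ab' : a <= b) by lra.
  assert (Cc : forall g, cont_on g a b -> forall x, continuous (fun y => g (clamp a b y)) x).
  { intros g Cg x; now apply continuous_clamp. }
  assert (Cp : forall x, continuous (fun y => / P (clamp a b y)) x).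
  { intros x; apply (continuous_comp (fun y => P (clamp a b y)) Rinv); [now apply Cc |].
    apply @ex_derive_continuous; auto_derive.
    apply Rgt_not_eq, P0; now apply clamp_in. }
  assert (bnd : forall g, (forall x, continuous (fun y => g (clamp a b y)) x) ->
    exists M, 0 < M /\ forall x, g (clamp a b x) <= M).
  { intros g Cg.
    destruct (bounded_above_continuous _ a b ab' Cg) as [M [M0 HM]].
    exists M; split; [exact M0 | intros x].
    assert (h := HM (clamp a b x) (clamp_in a b x ab')).
    now rewrite (clamp_id a b (clamp a b x)) in h by (now apply clamp_in). }
  destruct (bnd P (Cc P CP)) as [M1 [M10 HM1]].
  destruct (bnd (fun y => / P y) Cp) as [M2 [M20 HM2]].
  destruct (bnd A (Cc A CA)) as [M3 [M30 HM3]].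
  destruct (bnd B (Cc B CB)) as [M4 [M40 HM4]].
  (* [p = 1 / P] is bounded below by the inverse of an upper bound of [P]; the sum dominates the
     bounds of [p], [A] and [B] at once. *)
  exists (/ M1), (M2 + M3 + M4); constructor.
  - exact ab.
  - now apply Rinv_0_lt_compat.
  - exact Cp.
  - now apply Cc.
  - now apply Cc.
  - intros x; split; [| generalize (HM2 x); lra].
    apply Rinv_le_contravar; [apply P0; now apply clamp_in | apply HM1].
  - intros x; split; [apply A0; now apply clamp_in | generalize (HM3 x); lra].
  - intros x; split; [apply B0; now apply clamp_in | generalize (HM4 x); lra].
Qed.

Lemma positive_on_subinterval (B : R -> R) (a b c : R) :
  a < b -> cont_on B a b -> a <= c <= b -> 0 < B c ->
  exists c1 c2 e, a <= c1 /\ c1 < c2 /\ c2 <= b /\ 0 < e /\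
    forall x, c1 <= x <= c2 -> e <= B x.
Proof.
  intros ab CB Hc Bc.
  destruct (CB c Hc (B c / 2) ltac:(lra)) as [d [dp Hd]].
  exists (Rmax a (c - d / 2)), (Rmin b (c + d / 2)), (B c / 2).
  assert (q1 := Rmax_l a (c - d / 2)); assert (q2 := Rmax_r a (c - d / 2)).
  assert (q3 := Rmin_l b (c + d / 2)); assert (q4 := Rmin_r b (c + d / 2)).
  split; [exact q1 | split; [| split; [exact q3 | split; [lra |]]]].
  - apply Rmax_lub_lt; apply Rmin_glb_lt; lra.
  - intros x Hx.
    assert (h := Hd x ltac:(lra) ltac:(apply Rabs_lt_between; lra)).
    apply Rabs_lt_between in h; lra.
Qed.

(** With imaginary part 0 the equations for [u] and [v] decouple, and the left condition aligns each
    with the real solution [r sin th]. One factor is nonzero, so the right condition passes to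
    [th]. *)
Lemma real_eigenfunction_proportional P A B p a b m M h1 k1 h2 k2 la th r u v :
  coefficients p A B a b m M ->
  cont_on A a b -> cont_on B a b -> (forall x, a <= x <= b -> P x * p x = 1) ->
  th a = PI / 2 - atan (h1 - la * k1) ->
  (forall x, 0 < r x) ->
  (forall x, a <= x <= b ->
    is_derive (fun y => r y * sin (th y)) x (p x * (r x * cos (th x))) /\
    is_derive (fun y => r y * cos (th y)) x ((A x - B x * la) * (r x * sin (th x)))) ->
  eigenfunction P A B a b h1 k1 h2 k2 la 0 u v ->
  sin (th b - (PI / 2 + atan (h2 - la * k2))) = 0 /\
  exists C D, (C <> 0 \/ D <> 0) /\ forall x, a <= x <= b ->
    u x = C * (r x * sin (th x)) /\ v x = D * (r x * sin (th x)).
Proof.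
  intros H CA CB Pp tha r0 Dphi He.
  assert (ab := co_ab _ _ _ _ _ _ _ H).
  destruct (eigenfunction_first_order P A B p a b h1 k1 h2 k2 la 0 u v ab CA CB
    (co_p_cont _ _ _ _ _ _ _ H) Pp He) as [U [W [V [Z [DU [_ [DV [_ [DWZ E]]]]]]]]].
  destruct He as [_ [_ [bua [bva [bub [bvb nz]]]]]].
  destruct (E a ltac:(lra)) as [[ua [wa _]] [va [za _]]].
  destruct (E b ltac:(lra)) as [[ub [wb _]] [vb [zb _]]].
  rewrite wa, ua, va in bua; rewrite za, ua, va in bva.
  rewrite wb, ub, vb in bub; rewrite zb, ub, vb in bvb.
  assert (ini : cos (th a) = (h1 - la * k1) * sin (th a)).
  { rewrite tha, cos_minus, sin_minus, sin_PI2, cos_PI2, sin_atan_mul_cos; ring. }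
  assert (pos : forall x, a <= x <= b ->
    0 < (r x * sin (th x)) ^ 2 + (r x * cos (th x)) ^ 2).
  { intros x _; assert (h := sin2_cos2 (th x)); unfold Rsqr in h; assert (hr := r0 x).
    replace ((r x * sin (th x)) ^ 2 + (r x * cos (th x)) ^ 2)
      with (r x ^ 2 * (sin (th x) * sin (th x) + cos (th x) * cos (th x))) by ring.
    rewrite h, Rmult_1_r; now apply pow_lt. }
  destruct (proportional_solutions p (fun x => A x - B x * la) U W
    (fun y => r y * sin (th y)) (fun y => r y * cos (th y)) a b) as [C HC].
  { intros x Hx; split; [apply DU |].
    eapply is_derive_value; [apply DWZ, Hx | ring]. }
  { exact Dphi. }
  { exact pos. }
  { rewrite bua, ini; ring. }
  destruct (proportional_solutions p (fun x => A x - B x * la) V Z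
    (fun y => r y * sin (th y)) (fun y => r y * cos (th y)) a b) as [D HD].
  { intros x Hx; split; [apply DV |].
    eapply is_derive_value; [apply DWZ, Hx | ring]. }
  { exact Dphi. }
  { exact pos. }
  { rewrite bva, ini; ring. }
  assert (CD : C <> 0 \/ D <> 0).
  { destruct nz as [z [Hz nz]].
    destruct (E z Hz) as [[uz _] [vz _]]; rewrite uz, vz in nz.
    destruct (HC z Hz) as [hC _], (HD z Hz) as [hD _]; rewrite hC, hD in nz.
    destruct nz as [nz | nz]; [left | right]; intros ->; apply nz; ring. }
  split.
  - rewrite sin_minus_shifted_atan.
    assert (K : cos (th b) + (h2 - la * k2) * sin (th b) = 0).
    { destruct (HC b ltac:(lra)) as [e1 e2], (HD b ltac:(lra)) as [e3 e4].
      rewrite e1, e2 in bub; rewrite e3, e4 in bvb.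
      assert (hr := r0 b).
      assert (cancel : forall c, c <> 0 ->
        c * (r b * cos (th b)) = - ((h2 - la * k2) * (c * (r b * sin (th b)))) ->
        cos (th b) + (h2 - la * k2) * sin (th b) = 0).
      { intros c c0 e; apply Rmult_eq_reg_l with (c * r b).
        - rewrite Rmult_0_r; lra.
        - apply Rmult_integral_contrapositive_currified; lra. }
      destruct CD as [h | h]; [apply (cancel C h) | apply (cancel D h)]; lra. }
    rewrite K; ring.
  - exists C, D; split; [exact CD | intros x Hx].
    destruct (E x Hx) as [[-> _] [-> _]]; split; [apply HC, Hx | apply HD, Hx].
Qed.

Lemma pruefer_eigenfunction P A B p a b m M h1 k1 h2 k2 la th r :
  coefficients p A B a b m M ->
  (forall x, a <= x <= b -> P x * p x = 1) ->
  th a = PI / 2 - atan (h1 - la * k1) ->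
  sin (th b - (PI / 2 + atan (h2 - la * k2))) = 0 ->
  (forall x, 0 < r x) ->
  (forall x, a <= x <= b ->
    is_derive (fun y => r y * sin (th y)) x (p x * (r x * cos (th x))) /\
    is_derive (fun y => r y * cos (th y)) x ((A x - B x * la) * (r x * sin (th x)))) ->
  eigenfunction P A B a b h1 k1 h2 k2 la 0 (fun x => r x * sin (th x)) (fun _ => 0).
Proof.
  intros H Pp tha thb r0 Dphi.
  assert (ab := co_ab _ _ _ _ _ _ _ H).
  assert (ini : cos (th a) = (h1 - la * k1) * sin (th a)).
  { rewrite tha, cos_minus, sin_minus, sin_PI2, cos_PI2, sin_atan_mul_cos; ring. }
  assert (fin : cos (th b) = - ((h2 - la * k2) * sin (th b))).
  { rewrite sin_minus_shifted_atan in thb.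
    assert (h := cos_atan_pos (h2 - la * k2)).
    apply Rmult_integral in thb; destruct thb; lra. }
  assert (Dw : forall x, a <= x <= b ->
    P x * Derive (fun y => r y * sin (th y)) x = r x * cos (th x)).
  { intros x Hx; assert (E := is_derive_unique _ _ _ (proj1 (Dphi x Hx))); simpl in E; rewrite E.
    rewrite <- Rmult_assoc, Pp by exact Hx; ring. }
  split; [| split; [| split; [| split; [| split; [| split]]]]].
  - intros z Hz; split; [eexists; apply (Dphi z Hz) | apply ex_derive_const].
  - intros z Hz; split.
    + apply (is_derive_ext_loc (fun y => r y * cos (th y))).
      * apply (locally_interval _ z a b); [apply Hz | apply Hz |].
        simpl; intros y ya yb; symmetry; apply Dw; lra.
      * eapply is_derive_value; [exact (proj2 (Dphi z ltac:(lra))) | simpl; ring].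
    + apply (is_derive_ext (fun _ => 0)).
      * intros y; symmetry; change (P y * Derive (fun _ => 0) y = 0).
        rewrite Derive_const; ring.
      * eapply is_derive_value; [apply @is_derive_const | unfold zero; simpl; ring].
  - rewrite Dw, ini by lra; ring.
  - rewrite Derive_const; ring.
  - rewrite Dw, fin by lra; ring.
  - rewrite Derive_const; ring.
  - assert (h := r0 a); assert (s := sin2_cos2 (th a)); unfold Rsqr in s.
    exists a; split; [lra | left; intros e].
    apply Rmult_integral in e; destruct e as [e | e]; [lra |].
    rewrite ini, e in s; lra.
Qed.

(** All signs push one way: [B >= 0] and [k1 > 0] raise the angle with the parameter, [k2 > 0]
    lowers the target. [A >= 0] with [h1, h2 > 0] puts parameter 0 below every eigenvalue, and the
    point with [B c > 0] yields infinitely many. *)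
Theorem sturm_liouville (P A B : R -> R) (a b h1 k1 h2 k2 : R) :
  a < b -> cont_on P a b -> cont_on A a b -> cont_on B a b ->
  (forall x, a <= x <= b -> 0 < P x) ->
  (forall x, a <= x <= b -> 0 <= A x) -> (forall x, a <= x <= b -> 0 <= B x) ->
  (exists c, a <= c <= b /\ 0 < B c) ->
  0 < h1 -> 0 < k1 -> 0 < h2 -> 0 < k2 ->
  exists lam : nat -> R,
    0 < lam 0%nat /\ (forall k, lam k < lam (S k)) /\
    (forall la lb,
       (exists u v, eigenfunction P A B a b h1 k1 h2 k2 la lb u v)
       <-> (lb = 0 /\ exists k, la = lam k)) /\
    (forall k u v, eigenfunction P A B a b h1 k1 h2 k2 (lam k) 0 u v ->
       exactly_k_zeros u v a b k /\
       cont_on u a b /\ cont_on v a b /\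
       cont_on (Derive u) a b /\ cont_on (Derive v) a b).
Proof.
  intros ab CP CA CB P0 A0 B0 [c [Hc Bc]] h10 k10 h20 k20.
  assert (PI0 := PI_RGT_0).
  destruct (coefficients_clamp P A B a b ab CP CA CB P0 A0 B0) as [m [M H]].
  set (p := fun x => / P (clamp a b x)) in *.
  set (A' := fun x => A (clamp a b x)) in *.
  set (B' := fun x => B (clamp a b x)) in *.
  assert (EA : forall x, a <= x <= b -> A' x = A x).
  { intros x Hx; unfold A'; now rewrite clamp_id. }
  assert (EB : forall x, a <= x <= b -> B' x = B x).
  { intros x Hx; unfold B'; now rewrite clamp_id. }
  assert (Pp : forall x, a <= x <= b -> P x * p x = 1).
  { intros x Hx; unfold p; rewrite clamp_id by exact Hx.
    apply Rinv_r, Rgt_not_eq, P0, Hx. }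
  assert (CA' : cont_on A' a b) by (now apply (cont_on_ext A' A)).
  assert (CB' : cont_on B' a b) by (now apply (cont_on_ext B' B)).
  assert (ext : forall la lb u v, eigenfunction P A B a b h1 k1 h2 k2 la lb u v <->
                                  eigenfunction P A' B' a b h1 k1 h2 k2 la lb u v).
  { intros la lb u v; split; intros [e1 [e2 e3]];
      (split; [exact e1 | split; [| exact e3]]); intros z Hz; specialize (e2 z Hz).
    - now rewrite EA, EB by lra.
    - now rewrite EA, EB in e2 by lra. }
  set (alpha := fun l => PI / 2 - atan (h1 - l * k1)).
  set (th := fun l => proj1_sig (constructive_indefinite_description _
    (pruefer_angle_exists p A' B' a b m M l (alpha l) H))).
  assert (Hth : forall l, th l a = alpha l /\ pruefer_angle p A' B' a b l (th l)).
  { intros l; unfold th; now destruct (constructive_indefinite_description _ _). }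
  destruct (eigenvalue_sequence p A' B' a b m M h1 k1 h2 k2 th H)
    as [lam [lam0 [laminc [lamth lamall]]]]; try assumption.
  { apply (positive_on_subinterval B' a b c); try assumption.
    now rewrite EB. }
  { intros l; apply Hth. }
  { intros l; apply Hth. }
  assert (target : forall k, sin (th (lam k) b - (PI / 2 + atan (h2 - lam k * k2))) = 0).
  { intros k; rewrite lamth; apply sin_eq_0_1; exists (Z.of_nat k).
    rewrite <- INR_IZR_INZ; ring. }
  exists lam; split; [exact lam0 | split; [exact laminc | split]].
  - intros la lb; split.
    + intros [u [v He]]; apply ext in He.
      assert (lb0 : lb = 0).
      { destruct (Req_dec lb 0) as [e | lb0]; [exact e | exfalso].
        destruct (eigenfunction_first_order P A' B' p a b h1 k1 h2 k2 la lb u v ab CA' CB'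
          (co_p_cont _ _ _ _ _ _ _ H) Pp He)
          as [U [W [V [Z [DU [_ [DV [_ [DWZ E]]]]]]]]].
        destruct He as [_ [_ [bua [bva [bub [bvb [z [Hz nz]]]]]]]].
        destruct (E a ltac:(lra)) as [[ua [wa _]] [va [za _]]].
        destruct (E b ltac:(lra)) as [[ub [wb _]] [vb [zb _]]].
        rewrite wa, ua, va in bua; rewrite za, ua, va in bva.
        rewrite wb, ub, vb in bub; rewrite zb, ub, vb in bvb.
        destruct (nonreal_parameter_trivial p A' B' a b m M h1 k1 h2 k2 la lb U W V Z H
          k10 k20 lb0) with (x := z) as [u0 v0]; try assumption.
        { intros x Hx; split; [apply DU | apply DWZ, Hx]. }
        { intros x Hx; split; [apply DV | apply DWZ, Hx]. }
        destruct (E z Hz) as [[uz _] [vz _]]; rewrite uz, vz in nz; tauto. }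
      split; [exact lb0 | subst lb].
      destruct (Hth la) as [tha Ath].
      destruct (pruefer_solution p A' B' a b m M la (th la) H Ath) as [r [r0 Dr]].
      apply lamall.
      apply (real_eigenfunction_proportional P A' B' p a b m M h1 k1 h2 k2 la (th la) r u v);
        assumption.
    + intros [-> [k ->]].
      destruct (Hth (lam k)) as [tha Ath].
      destruct (pruefer_solution p A' B' a b m M _ _ H Ath) as [r [r0 Dr]].
      exists (fun x => r x * sin (th (lam k) x)), (fun _ => 0); apply ext.
      apply (pruefer_eigenfunction P A' B' p a b m M); try assumption.
      apply target.
  - intros k u v He; apply ext in He.
    destruct (Hth (lam k)) as [tha Ath].
    destruct (pruefer_solution p A' B' a b m M _ _ H Ath) as [r [r0 Dr]].
    destruct (real_eigenfunction_proportional P A' B' p a b m M h1 k1 h2 k2 (lam k)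
      (th (lam k)) r u v) as [_ [C [D [CD Euv]]]]; try assumption.
    destruct (eigenfunction_first_order P A' B' p a b h1 k1 h2 k2 (lam k) 0 u v ab CA' CB'
      (co_p_cont _ _ _ _ _ _ _ H) Pp He) as [U [W [V [Z [DU [DW [DV [DZ [_ E]]]]]]]]].
    split; [| split; [| split; [| split]]].
    + destruct (pruefer_angle_zeros p A' B' a b m M (lam k) (th (lam k)) k H Ath)
        as [l [ll [nd Hl]]].
      { rewrite tha; unfold alpha; assert (q := atan_bound (h1 - lam k * k1)); lra. }
      (* The target lies in [(0, PI)], so the angle at [b] lies strictly between [k PI] and
         [(k + 1) PI]. *)
      { rewrite lamth, S_INR; assert (q := atan_bound (h2 - lam k * k2)); lra. }
      exists l; split; [exact ll | split; [exact nd |]].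
      intros x; rewrite Hl; split.
      * intros [Hx s]; destruct (Euv x ltac:(lra)) as [-> ->].
        rewrite s; split; [exact Hx | split; ring].
      * intros [Hx [ux vx]]; split; [exact Hx |].
        destruct (Euv x ltac:(lra)) as [e1 e2]; rewrite e1 in ux; rewrite e2 in vx.
        assert (hr := r0 x).
        apply Rmult_integral in ux; apply Rmult_integral in vx.
        destruct CD as [n | n].
        -- destruct ux as [ux | ux]; [contradiction |].
           apply Rmult_integral in ux; destruct ux; [lra | assumption].
        -- destruct vx as [vx | vx]; [contradiction |].
           apply Rmult_integral in vx; destruct vx; [lra | assumption].
    + apply (cont_on_ext u U); [intros x Hx; apply E, Hx |].
      apply cont_on_continuous; intros x _; apply @ex_derive_continuous; eexists; apply DU.
    + apply (cont_on_ext v V); [intros x Hx; apply E, Hx |].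
      apply cont_on_continuous; intros x _; apply @ex_derive_continuous; eexists; apply DV.
    + apply (cont_on_ext _ (fun x => p x * W x)); [intros x Hx; apply E, Hx |].
      apply cont_on_continuous; intros x _; apply (continuous_mult p W);
        [apply (co_p_cont _ _ _ _ _ _ _ H) | apply @ex_derive_continuous, DW].
    + apply (cont_on_ext _ (fun x => p x * Z x)); [intros x Hx; apply E, Hx |].
      apply cont_on_continuous; intros x _; apply (continuous_mult p Z);
        [apply (co_p_cont _ _ _ _ _ _ _ H) | apply @ex_derive_continuous, DZ].
Qed.

(** * Reduction of the Hele-Shaw problem to the abstract one *)

Theorem theorem1 (Q n mui muo R10 R20 tau T1 T2 : R) (mu : R -> R) :
  0 < Q -> 0 < n -> 0 < mui -> 0 < muo -> 0 < R10 -> R10 < R20 -> 0 <= tau ->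
  0 < F1 mu Q n mui R10 R20 tau T1 ->
  0 < F2 mu Q n muo R20 tau T2 ->
  (forall z, zeta1 R10 R20 <= z <= 1 -> 0 < mu z) ->
  (forall x y, zeta1 R10 R20 <= x -> x < y -> y <= 1 -> mu x < mu y) ->
  C1_on mu (zeta1 R10 R20) 1 ->
  exists lam : nat -> R,
    0 < lam 0%nat /\
    (forall k, lam k < lam (S k)) /\
    (* the eigenvalues (lambda = la + i lb in C) are exactly the lam k *)
    (forall la lb : R,
       (exists u v, eigenpair mu Q n mui muo R10 R20 tau T1 T2 la lb u v)
       <-> (lb = 0 /\ exists k, la = lam k)) /\
    (* every eigenfunction of lam k has exactly k zeros in (zeta1,1) and is C^1 *)
    (forall k u v, eigenpair mu Q n mui muo R10 R20 tau T1 T2 (lam k) 0 u v ->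
       exactly_k_zeros u v (zeta1 R10 R20) 1 k /\
       cont_on u (zeta1 R10 R20) 1 /\ cont_on v (zeta1 R10 R20) 1 /\
       cont_on (Derive u) (zeta1 R10 R20) 1 /\ cont_on (Derive v) (zeta1 R10 R20) 1).
Proof.
  intros Q0 n0 mui0 muo0 R100 R1020 tau0 F10 F20 mu0 muinc [Dmu Cmu].
  set (z1 := zeta1 R10 R20) in *; set (r0 := R0sq Q tau).
  set (f1 := F1 mu Q n mui R10 R20 tau T1) in *.
  set (f2 := F2 mu Q n muo R20 tau T2) in *.
  assert (PI0 := PI_RGT_0).
  assert (R20sq : 0 < R20 ^ 2) by (apply pow_lt; lra).
  assert (R10sq : 0 < R10 ^ 2) by (apply pow_lt; lra).
  assert (z1R : z1 * R20 ^ 2 = R10 ^ 2) by (unfold z1, zeta1; field; lra).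
  assert (z10 : 0 < z1) by (now apply Rdiv_lt_0_compat).
  assert (z11 : z1 < 1) by nra.
  assert (r00 : 0 <= r0).
  { unfold r0, R0sq; apply Rdiv_le_0_compat; [nra | lra]. }
  assert (s0 : forall z, z1 <= z <= 1 -> 0 < z * R20 ^ 2 + r0) by (intros z Hz; nra).
  set (P := fun z => (z * R20 ^ 2 + r0) * mu z).
  set (A := fun z => n ^ 2 * R20 ^ 4 / (4 * (z * R20 ^ 2 + r0)) * mu z).
  set (B := fun z => Q * n ^ 2 * R20 ^ 2 / (4 * PI * (z * R20 ^ 2 + r0)) * Derive mu z).
  (* Multiplying the boundary conditions by [K] turns the given coefficients of the derivative into
     [P z1] and [P 1], since [z R20 ^ 2 + r0] equals [R1sq] at [z1] and [R2sq] at 1. *)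
  set (K := n * R20 ^ 2 / 2).
  assert (K0 : 0 < K) by (unfold K; nra).
  assert (cmu : cont_on mu z1 1).
  { apply cont_on_continuous; intros x Hx; apply @ex_derive_continuous, Dmu, Hx. }
  assert (smooth : forall g : R -> R, (forall x, z1 <= x <= 1 -> ex_derive g x) ->
    cont_on g z1 1).
  { intros g Hg; apply cont_on_continuous; intros x Hx.
    apply @ex_derive_continuous, Hg, Hx. }
  assert (dmu0 : forall x, z1 <= x <= 1 -> 0 <= Derive mu x).
  { intros x Hx; apply (derive_nonneg_of_monotone mu z1 1 x); try assumption.
    - intros y z h1 [h2 | <-] h3; [left; now apply muinc | apply Rle_refl].
    - apply Derive_correct, Dmu, Hx. }
  assert (n2 : 0 < n ^ 2) by (now apply pow_lt).
  assert (Bc0 : forall x, z1 <= x <= 1 ->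
    0 < Q * n ^ 2 * R20 ^ 2 / (4 * PI * (x * R20 ^ 2 + r0))).
  { intros x Hx; specialize (s0 x Hx); apply Rdiv_lt_0_compat.
    - do 2 (apply Rmult_lt_0_compat; [| assumption]); assumption.
    - do 2 (apply Rmult_lt_0_compat; try lra). }
  destruct (sturm_liouville P A B z1 1 (K * mui) (K * f1) (K * muo) (K * f2))
    as [lam [lam0 [laminc [lamall lamzeros]]]]; try assumption.
  { apply cont_on_mult; [apply smooth | exact cmu | lra].
    intros x _; auto_derive; trivial. }
  { apply cont_on_mult; [apply smooth | exact cmu | lra].
    intros x Hx; specialize (s0 x Hx); auto_derive; lra. }
  { apply cont_on_mult; [apply smooth | exact Cmu | lra].
    intros x Hx; specialize (s0 x Hx); auto_derive.
    apply Rgt_not_eq, Rmult_lt_0_compat; lra. }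
  { intros x Hx; apply Rmult_lt_0_compat; [now apply s0 | now apply mu0]. }
  { intros x Hx; apply Rmult_le_pos; [| left; now apply mu0].
    specialize (s0 x Hx); apply Rdiv_le_0_compat; [| lra].
    apply Rmult_le_pos; [lra |]; left; apply pow_lt; lra. }
  { intros x Hx; apply Rmult_le_pos; [left; now apply Bc0 | now apply dmu0]. }
  (* Strict monotonicity allows zeros of the derivative; the mean value theorem between the
     endpoints still supplies a point where it is positive. *)
  { destruct (mean_value mu (Derive mu) z1 1) as [c [Hc E]]; [lra | |].
    - intros x Hx; apply Derive_correct, Dmu, Hx.
    - exists c; split; [exact Hc | apply Rmult_lt_0_compat; [now apply Bc0 |]].
      assert (mu z1 < mu 1) by (apply muinc; lra); nra. }
  1-4: now apply Rmult_lt_0_compat.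
  assert (Pz1 : P z1 = K * (2 * R1sq Q tau R10 / (n * R20 ^ 2) * mu z1)).
  { unfold P, K, R1sq; rewrite z1R; unfold r0, R0sq; field; lra. }
  assert (P1 : P 1 = K * (2 * R2sq Q tau R20 / (n * R20 ^ 2) * mu 1)).
  { unfold P, K, R2sq, r0, R0sq; field; lra. }
  assert (equiv : forall la lb u v,
    eigenpair mu Q n mui muo R10 R20 tau T1 T2 la lb u v <->
    eigenfunction P A B z1 1 (K * mui) (K * f1) (K * muo) (K * f2) la lb u v).
  { intros la lb u v; unfold eigenpair, eigenfunction; cbv zeta.
    fold z1 r0 f1 f2 P A B; rewrite Pz1, P1.
    set (c1 := 2 * R1sq Q tau R10 / (n * R20 ^ 2)).
    set (c2 := 2 * R2sq Q tau R20 / (n * R20 ^ 2)).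
    split; intros [e1 [e2 [e3 [e4 [e5 [e6 e7]]]]]].
    - do 2 (split; [assumption |]).
      split; [| split; [| split; [| split; [| exact e7]]]].
      + transitivity (K * (c1 * mu z1 * Derive u z1)); [ring |].
        transitivity (K * ((mui - la * f1) * u z1 + lb * f1 * v z1)); [f_equal; lra | ring].
      + transitivity (K * (c1 * mu z1 * Derive v z1)); [ring |].
        transitivity (K * ((mui - la * f1) * v z1 - lb * f1 * u z1)); [f_equal; lra | ring].
      + transitivity (K * (c2 * mu 1 * Derive u 1)); [ring |].
        transitivity (K * - ((muo - la * f2) * u 1 + lb * f2 * v 1)); [f_equal; lra | ring].
      + transitivity (K * (c2 * mu 1 * Derive v 1)); [ring |].
        transitivity (K * - ((muo - la * f2) * v 1 - lb * f2 * u 1)); [f_equal; lra | ring].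
    - do 2 (split; [assumption |]).
      split; [| split; [| split; [| split; [| exact e7]]]];
        apply Rmult_eq_reg_l with K; lra. }
  exists lam; split; [exact lam0 | split; [exact laminc | split]].
  - intros la lb; rewrite <- lamall; split; intros [u [v He]]; exists u, v;
      now apply equiv.
  - intros k u v He; apply lamzeros; now apply equiv.
Qed.
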